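(* Consider a score function of the form $\xi(\Psi)=\sum_i H(X_i,M_i',S_{X_i}\Phi)$ for a measurable function $H$ on $\mathbb R^d\times\mathbb M'\times\mathbb N^0_{\mathbb M}$ with values either in $[0,\infty)\cup\{-\infty\}$ or in $[-\infty,0]$, and let $f(m',\varphi)=\sum_{x\in\varphi}H(-x,m',\varphi)$ for $m'\in\mathbb M'$, $\varphi\in\mathbb N^0_{\mathbb M}$. Assume that $f$ is continuous in $m'$ for $\mathbb P^0$-almost all realizations $\varphi$ of the base process $\Phi$. Then $$\gamma_{\xi,\mathsf{opt}}=\lambda\,\mathbb E^0\Big[\sup_{m'\in\mathbb M'}f(m',\Phi)\Big].$$
   Context: $\mathbb M,\mathbb M'$ are locally compact, second countable, Hausdorff spaces. For such a space $\mathbb K$, $\mathbb N_{\mathbb K}$ is the set of locally finite subsets of $\mathbb R^d\times\mathbb K$ containing at most one element of each $\{x\}\times\mathbb K$, with the evaluation $\sigma$-algebra; $\mathbb N^0_{\mathbb M}$ and $\mathbb N^0_{\mathbb M\times\mathbb M'}$ are the subsets of configurations having a point at the origin $o$. $S_y$ shifts atoms $(x,m)\mapsto(x-y,m)$, resp. $(x,m,m')\mapsto(x-y,m,m')$; $\pi:\mathbb N_{\mathbb M\times\mathbb M'}\to\mathbb N_{\mathbb M}$ forgets the $\mathbb M'$-marks; $x\in\varphi$ also denotes the location of an atom of $\varphi$. $\Phi=\{(X_i,M_i)\}_i$ is a given stationary random element of $\mathbb N_{\mathbb M}$ with intensity $\lambda=\mathbb E[\Phi([0,1]^d\times\mathbb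 M)]\in(0,\infty)$. $\mathcal T(\Phi)$ is the set of (laws of) stationary markings of $\Phi$: stationary random elements $\Psi=\{(X_i,M_i,M_i')\}_i$ of $\mathbb N_{\mathbb M\times\mathbb M'}$, possibly on a new probability space, with $\pi(\Psi)$ distributed as $\Phi$ (one then re-defines $\Phi:=\pi(\Psi)$). $\mathbb P^0,\mathbb E^0$ denote Palm probability and expectation with respect to the points $X_i$; under it there is a point $X_0=o$. The score $\xi$ is evaluated on $\mathbb N^0_{\mathbb M\times\mathbb M'}$, and the $\xi$-intensity is $\gamma_\xi(\Psi)=\mathbb E[\sum_{X_i\in\Psi\cap[0,1]^d}\xi(S_{X_i}\Psi)]=\lambda\mathbb E^0[\xi(\Psi)]$, and $\gamma_{\xi,\mathsf{opt}}=\sup_{\Psi\in\mathcal T(\Phi)}\gamma_\xi(\Psi)$. The series defining $\xi$ and $f$ take the value $-\infty$ if at least one term is $-\infty$; likewise expectations take the value $-\infty$ if a quantity with values in $[0,\infty]\cup\{-\infty\}$ equals $-\infty$ with positive probability. *)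

(* Defs.v *)
From HB Require Import structures.
From mathcomp Require Import all_boot all_order all_algebra.
From mathcomp Require Import all_classical all_reals all_analysis.
From mathcomp Require Import measurable_realfun.

Set Implicit Arguments.
Unset Strict Implicit.
Unset Printing Implicit Defensive.

Import Order.TTheory GRing.Theory Num.Theory.
Import numFieldNormedType.Exports.

Local Open Scope classical_set_scope.
Local Open Scope ring_scope.

HB.instance Definition _ (T U : ptopologicalType) := Pointed.on (T * U)%type.

Notation borel T := (g_sigma_algebraType (@open T)).

(* Local finiteness refers to the locations: finitely many atoms in B x K for
   each bounded B.  This is what makes forgetting marks a total operation;
   finiteness on compact sets of R^d x (M x M') would not pass to R^d x M. *)
Record config (R : realType) (d : nat) (K : ptopologicalType) := Config {
  atoms : set ('rV[R]_d * K) ;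
  config_locally_finite : forall B : set 'rV[R]_d, bounded_set B ->
    finite_set (atoms `&` (B `*` setT)) ;
  config_one_mark : forall x m1 m2, atoms (x, m1) -> atoms (x, m2) -> m1 = m2
}.

Section config_instances.
Context (R : realType) (d : nat) (K : ptopologicalType).

Program Definition empty_config : config R d K := @Config R d K set0 _ _.
Next Obligation. by move=> B _; rewrite set0I. Qed.
Next Obligation. by []. Qed.

HB.instance Definition _ := gen_eqMixin (config R d K).
HB.instance Definition _ := gen_choiceMixin (config R d K).
HB.instance Definition _ := isPointed.Build (config R d K) empty_config.

Definition evaluation (B : set ('rV[R]_d * K)) (phi : config R d K) : \bar R :=
  counting (atoms phi `&` B).

Definition evaluation_sets : set (set (config R d K)) :=
  [set E | exists (B : set (borel ('rV[R]_d * K)%type)) (Y : set (\bar R)),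
    [/\ measurable B, measurable Y & E = evaluation B @^-1` Y]].

HB.instance Definition _ := @isMeasurable.Build (sigma_display evaluation_sets)
  (config R d K) <<s evaluation_sets >>
  (@sigma_algebra0 _ setT evaluation_sets) (@sigma_algebraC _ evaluation_sets)
  (@sigma_algebra_bigcup _ setT evaluation_sets).

End config_instances.

Section config_operations.
Context (R : realType) (d : nat).

Definition locations (K : ptopologicalType) (phi : config R d K) :
  set 'rV[R]_d := fst @` atoms phi.

Definition at_origin (K : ptopologicalType) : set (config R d K) :=
  [set phi | locations phi 0].

Definition unit_cube : set 'rV[R]_d :=
  [set x | forall j, 0 <= x ord0 j <= 1].

Lemma bounded_translate (B : set 'rV[R]_d) (y : 'rV[R]_d) :
  bounded_set B -> bounded_set [set x | B (x - y)].
Proof.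
move=> [r [rreal hr]]; exists (r + 1 + `|y|).
split; first by rewrite num_real.
move=> s ls x /= Bxy.
have := hr (r + 1) _ (x - y) Bxy; rewrite ltrDl ltr01 => /(_ isT) h.
apply: (le_trans _ (ltW ls)); rewrite -[x in `|x|](subrK y).
by rewrite (le_trans (ler_normD _ _))// lerD2r.
Qed.

Program Definition shift (K : ptopologicalType) (y : 'rV[R]_d)
    (phi : config R d K) : config R d K :=
  @Config R d K ((fun a => (a.1 - y, a.2)) @` atoms phi) _ _.
Next Obligation.
move=> K y phi B bB.
apply: (@sub_finite_set _ _ ((fun a : 'rV[R]_d * K => (a.1 - y, a.2)) @`
  (atoms phi `&` ([set x | B (x - y)] `*` setT)))).
  move=> _ [[[x m] /= phia <-]] [/= Bx _].
  by exists (x, m).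
by apply: finite_image; apply: config_locally_finite; exact: bounded_translate.
Qed.
Next Obligation.
move=> K y phi x m1 m2 [[x1 n1] /= a1 [e1 <-]] [[x2 n2] /= a2 [e2 <-]].
have e : x1 = x2 by apply: (addIr (- y)); rewrite e1 e2.
by apply: config_one_mark a1 _; rewrite e.
Qed.

Program Definition forget (M M' : ptopologicalType)
    (psi : config R d (M * M')%type) : config R d M :=
  @Config R d M ((fun a => (a.1, a.2.1)) @` atoms psi) _ _.
Next Obligation.
move=> M M' psi B bB.
apply: (@sub_finite_set _ _ ((fun a : 'rV[R]_d * (M * M') => (a.1, a.2.1)) @`
  (atoms psi `&` (B `*` setT)))).
  by move=> _ [[[x m] /= psia <-]] [/= Bx _]; exists (x, m).
by apply: finite_image; exact: config_locally_finite.
Qed.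
Next Obligation.
move=> M M' psi x m1 m2 [[x1 n1] /= a1 [<- <-]] [[x2 n2] /= a2 [e2 <-]].
by subst x2; rewrite (config_one_mark a1 a2).
Qed.

End config_operations.

Section extended_sums.
Context (R : realType).
Local Open Scope ereal_scope.

(* Both operations are used for functions valued in [0, +oo] U {-oo} or in
   [-oo, 0]; attaining -oo (resp. with positive mass) forces the value -oo. *)
Definition esumNy (I : choiceType) (A : set I) (a : I -> \bar R) : \bar R :=
  if `[< exists2 i, A i & a i = -oo >] then -oo
  else \esum_(i in A) a^\+ i - \esum_(i in A) a^\- i.

Definition expectNy (dT : measure_display) (T : measurableType dT)
    (mu : set T -> \bar R) (g : T -> \bar R) : \bar R :=
  if `[< {ae mu, forall t, g t <> -oo} >] then \int[mu]_t g t else -oo.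

End extended_sums.

Section point_processes.
Context (R : realType) (d : nat).
Local Open Scope ereal_scope.

(* Below, mu is the law of a random element of config R d K. *)

Definition stationary (K : ptopologicalType) (mu : set (config R d K) -> \bar R) :=
  forall (y : 'rV[R]_d) (A : set (config R d K)), measurable A ->
    mu (shift y @^-1` A) = mu A.

Definition intensity (K : ptopologicalType) (mu : set (config R d K) -> \bar R) :=
  \int[mu]_phi evaluation ((@unit_cube R d) `*` setT) phi.

Definition palm (K : ptopologicalType) (mu : set (config R d K) -> \bar R)
    (A : set (config R d K)) : \bar R :=
  (intensity mu)^-1 *
    \int[mu]_phi \esum_(x in locations phi `&` @unit_cube R d)
      (\1_A (shift x phi))%:E.

Definition score_intensity (K : ptopologicalType)
    (mu : set (config R d K) -> \bar R) (xi : config R d K -> \bar R) : \bar R :=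
  expectNy mu (fun psi =>
    esumNy (locations psi `&` @unit_cube R d) (fun x => xi (shift x psi))).

Definition stationary_markings (M M' : ptopologicalType)
    (mu : set (config R d M) -> \bar R) :
    set (probability (config R d (M * M')%type) R) :=
  [set Q | stationary Q /\
    forall A : set (config R d M), measurable A ->
      Q (@forget R d M M' @^-1` A) = mu A].

Definition opt_score_intensity (M M' : ptopologicalType)
    (mu : set (config R d M) -> \bar R)
    (xi : config R d (M * M')%type -> \bar R) : \bar R :=
  ereal_sup [set score_intensity Q xi | Q in @stationary_markings M M' mu].

Definition pair_score (M M' : ptopologicalType)
    (H : 'rV[R]_d -> M' -> config R d M -> \bar R)
    (psi : config R d (M * M')%type) : \bar R :=
  esumNy (atoms psi) (fun a => H a.1 a.2.2 (shift a.1 (forget psi))).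

Definition transported_score (M M' : ptopologicalType)
    (H : 'rV[R]_d -> M' -> config R d M -> \bar R)
    (m' : M') (phi : config R d M) : \bar R :=
  esumNy (locations phi) (fun x => H (- x)%R m' phi).

End point_processes.

(* Main.v *)
From Pilot Require Import Defs.
From HB Require Import structures.
From mathcomp Require Import all_boot all_order all_algebra.
From mathcomp Require Import all_classical all_reals all_analysis.
From mathcomp Require Import measurable_realfun finmap.

(* [shift] has to denote the shift of configurations again. *)
Import Pilot.Defs.

Set Implicit Arguments.
Unset Strict Implicit.
Unset Printing Implicit Defensive.

Import Order.TTheory GRing.Theory Num.Theory.
Import numFieldNormedType.Exports.

Local Open Scope classical_set_scope.
Local Open Scope ring_scope.
Local Open Scope ereal_scope.

(** In a marking, the point x has the score given by the sum of
   H(z - x, m'_z, S_z Phi) over all points z.  The expected sum of these scores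
   over the points x of the unit cube does not change if the sum over x in the
   cube and the sum over all z exchange their ranges: this is the mass transport
   principle for stationary processes ([mass_transport]).  The inner sum over x
   is then f(m'_z, S_z Phi), so that the score intensity is the expected sum of
   f(m'_z, S_z Phi) over the points z of the cube
   ([score_intensity_pair_score]), and the new marks of distinct points do not
   interact any more.

   Hence a marking does at best as well as if every point z contributed the
   supremum of f over all marks.  The supremum is a function of S_z Phi, and the
   expected sum of a function of S_z Phi over the points of the cube is lambda
   times its Palm expectation; this is the upper bound ([score_intensity_le]).

   It is approached by markings in which m'_z is a measurable function of
   S_z Phi ([mark]); these are stationary and project to Phi.  By continuity,
   the supremum may be taken over a sequence that is dense in the space of
   marks, and m'_z is the first member of the sequence for which f comes within
   1/(n+1) of the supremum truncated at n ([select]).  The score intensity is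
   then lambda times the Palm expectation of f at this mark
   ([score_intensity_mark]), and monotone convergence gives the limit
   ([expectation_near_optimal]).

   Two points need care.  The sigma-algebra on configurations is generated by
   numbers of atoms only; sums over atoms with parameters are measurable because
   a configuration is a kernel that is finite on bounded regions
   ([measurable_esum_atoms]).  The conventions about the value -oo agree with
   the rule that +oo minus +oo is -oo, and sums and expectations are computed as
   differences of nonnegative ones.  This commutes with the exchange of sums as
   long as all values stay in one of the two classes admitted for H
   ([signed]). *)

(** * Borel sets of product spaces *)

Lemma measurable_continuous (X Y : ptopologicalType) (f : X -> Y) :
  continuous f -> measurable_fun setT (f : borel X -> borel Y).
Proof.
move=> cf; apply: (@measurability _ _ _ (borel Y) _ _ (@open Y)) => //.
move=> _ [U oU <-]; rewrite setTI; apply: sub_sigma_algebra.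
by move/continuousP: cf; exact.
Qed.

Lemma measurable_open (X : ptopologicalType) (U : set X) :
  open U -> measurable (U : set (borel X)).
Proof. exact: sub_sigma_algebra. Qed.

Lemma measurable_closed (X : ptopologicalType) (U : set X) :
  closed U -> measurable (U : set (borel X)).
Proof.
move=> cU; rewrite -[U]setCK; apply: measurableC.
by apply: measurable_open; rewrite openC.
Qed.

Lemma countable_bigcup_measurable d (T : measurableType d) (I : Type)
    (B : set I) (F : I -> set T) :
  countable B -> (forall i, B i -> measurable (F i)) ->
  measurable (\bigcup_(i in B) F i).
Proof.
move=> /pfcard_geP[->|[f]] mF; first by rewrite bigcup_set0.
rewrite -(image_eq f) bigcup_image; apply: bigcup_measurable => k _.
by apply: mF; exact: funS.
Qed.

(** One countable basis suffices: for each basic open set [U] of [X], all open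
   sets [V] with [U `*` V `<=` W] are merged into one. *)
Lemma open_measurable_prod (X Y : ptopologicalType) (W : set (X * Y)) :
  @second_countable X -> open W -> measurable (W : set (borel X * borel Y)).
Proof.
move=> [B cB [Bo Bb]] oW.
pose slab U := \bigcup_(V in [set V : set Y | open V /\ U `*` V `<=` W]) V.
have -> : W = \bigcup_(U in B) (U `*` slab U).
  apply/seteqP; split=> [[x y] Wxy|[x y] [U BU [/= Ux [V [oV UVW] Vy]]]].
    move: oW; rewrite openE => /(_ _ Wxy) [[P Q] /= [nP nQ] PQW].
    have [U [BU Ux] UP] := Bb x P nP.
    exists U => //; split => //=.
    move: nQ; rewrite nbhsE => -[V [oV Vy] VQ].
    exists V => //=; split=> // -[x' y'] [/= Ux' Vy'].
    by apply: PQW; split => /=; [exact: UP|exact: VQ].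
  by apply: UVW.
apply: countable_bigcup_measurable => // U BU.
apply: measurableX; first exact: measurable_open (Bo _ BU).
by apply: measurable_open; apply: bigcup_open => V [].
Qed.

Lemma measurable_continuous_prod (X Y Z : ptopologicalType) (f : X * Y -> Z) :
  @second_countable X -> continuous f ->
  measurable_fun setT (f : borel X * borel Y -> borel Z).
Proof.
move=> scX cf; apply: (@measurability _ _ _ (borel Z) _ _ (@open Z)) => //.
move=> _ [U oU <-]; rewrite setTI; apply: open_measurable_prod => //.
by move/continuousP: cf; exact.
Qed.

(** The balls with rational center and radius 1/(n+1) form a basis. *)
Lemma second_countable_rV (R : realType) (d : nat) :
  @second_countable 'rV[R]_d.
Proof.
pose F (p : 'rV[rat]_d * nat) : set 'rV[R]_d :=
  @ball R 'rV[R]_d (map_mx ratr p.1) (p.2.+1%:R^-1)%R.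
exists (F @` setT); first exact: card_le_trans (card_image_le _ _) (countableP _).
split=> [_ [p _ <-]|x A]; first exact: ball_open.
move=> /nbhs_ballP[e /= e0 xeA].
have [n ne] : exists n, (n.+1%:R^-1 < e / 2)%R.
  have e20 : (0 < e / 2)%R by rewrite divr_gt0.
  by have [n _ /(_ n (leqnn n))] := near_infty_natSinv_lt (PosNum e20); exists n.
have n0 : (0 < n.+1%:R^-1 :> R)%R by rewrite invr_gt0.
have /choice[q qx] : forall j, exists q :
  rat, (`|ratr q - x ord0 j| < n.+1%:R^-1)%R.
  move=> j; have : (x ord0 j - n.+1%:R^-1 < x ord0 j + n.+1%:R^-1)%R.
    by rewrite ltrBlDr -addrA ltrDl addr_gt0.
  move=> /rat_in_itvoo[q]; rewrite in_itv /= => /andP[q1 q2]; exists q.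
  by rewrite ltr_distl q1 q2.
exists (F ((\row_j q j)%R, n)).
  split; first by exists ((\row_j q j)%R, n).
  split=> // i j; rewrite !mxE /ball /= (ord1 i); exact: qx.
move=> y [_ Fy]; apply: xeA;
  apply: (@ball_splitr R 'rV[R]_d (map_mx ratr ((\row_j q j)%R))).
  split=> [|i j]; first by rewrite divr_gt0.
  by rewrite !mxE (ord1 i) /ball /=; exact: lt_trans (qx j) ne.
split=> [|i j]; first by rewrite divr_gt0.
exact: lt_trans (Fy i j) ne.
Qed.

Lemma continuous_pair (X Y Z : topologicalType) (f : X -> Y) (g : X -> Z) :
  continuous f -> continuous g -> continuous (fun x => (f x, g x)).
Proof. by move=> cf cg x; apply: cvg_pair; [exact: cf|exact: cg]. Qed.

Lemma continuous_fst (X Y : topologicalType) : continuous (@fst X Y).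
Proof. by move=> x; exact: cvg_fst. Qed.

Lemma continuous_snd (X Y : topologicalType) : continuous (@snd X Y).
Proof. by move=> x; exact: cvg_snd. Qed.

Lemma continuous_compT (X Y Z : topologicalType) (f : X -> Y) (g : Y -> Z) :
  continuous f -> continuous g -> continuous (g \o f).
Proof. by move=> cf cg x; apply: continuous_comp; [exact: cf|exact: cg]. Qed.

(** * Counting the elements of a set *)

Lemma counting_esum (R : realType) (T : choiceType) (A : set T) :
  counting A = \esum_(a in A) 1 :> \bar R.
Proof.
rewrite /counting; case: asboolP => [fA|infA].
  by rewrite esum_fset// fsbig_finite//= sumEFin big_const_seq count_predT
    iter_addr_0.
apply/esym/eqyP => r r0; have [n rn] : exists n, (r <= n%:R)%R.
  by exists (Num.truncn r).+1; exact/ltW/truncnS_gt.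
have [B BA nB] := infinite_set_fset n infA.
rewrite (@le_trans _ _ n%:R%:E) ?lee_fin//.
apply: esum_ge; exists [set` B] => //.
rewrite fsbig_finite//= sumEFin big_const_seq count_predT set_fsetK.
by rewrite iter_addr_0 lee_fin ler_nat.
Qed.

Section point_measure.
Context (R : realType) d (T : measurableType d).
Implicit Types (A B : set T).

(** A sum over a classical set is additive on all sets; in this form the
   measure is at hand for every set of atoms [A]. *)
Definition point_measure A B : \bar R := \esum_(a in A `&` B) 1.

Let point_measure0 A : point_measure A set0 = 0.
Proof. by rewrite /point_measure setI0 esum_set0. Qed.

Let point_measure_ge0 A B : 0 <= point_measure A B.
Proof. by apply: esum_ge0. Qed.

Let point_measure_sigma_additive A : semi_sigma_additive (point_measure A).
Proof.
move=> F mF tF mU.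
rewrite [X in _ --> X](_ : _ = \sum_(0 <= i <oo) point_measure A (F i)).
  by apply: is_cvg_nneseries => n _ _; exact: point_measure_ge0.
rewrite /point_measure setI_bigcupr esum_bigcupT//; last first.
  apply/trivIsetP => i j _ _ ij; move/trivIsetP: tF => /(_ i j Logic.I Logic.I ij).
  by rewrite setIACA => ->; rewrite setI0.
by rewrite nneseries_esumT// => n; exact: point_measure_ge0.
Qed.

HB.instance Definition _ A := isMeasure.Build _ _ _ (point_measure A)
  (point_measure0 A) (point_measure_ge0 A) (@point_measure_sigma_additive A).

(** An enumeration of [A] writes its counting measure as a series of Dirac
   masses. *)
Lemma integral_point_measure A (f : T -> \bar R) : countable A ->
  (forall x, 0 <= f x) -> measurable_fun setT f ->
  \int[point_measure A]_x f x = \esum_(a in A) f a.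
Proof.
move=> /countable_injP[e einj] f0 mf.
pose D n := A `&` e @^-1` [set n].
have tD : trivIset setT D.
  by move=> i j _ _ [x [[_ /= <-] [_ /= <-]]].
have AD : A = \bigcup_n D n.
  by apply/seteqP; split=> [a Aa|a [n _ []]//]; exists (e a).
rewrite (@eq_measure_integral _ _ _ _ (mseries (fun n => point_measure (D n)) 0)).
  rewrite ge0_integral_measure_series//= AD esum_bigcupT//.
  rewrite nneseries_esumT => [|n]; last by apply: integral_ge0.
  apply: eq_esum => n _.
  have [->|/set0P[a Da]] := eqVneq (D n) set0.
    rewrite esum_set0 (@eq_measure_integral _ _ _ _ mzero).
      by rewrite integral_measure_zero.
    by move=> B _ _; rewrite /= /point_measure set0I esum_set0.
  have [Aa /= ea] : D n a := Da.
  have -> : D n = [set a].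
    apply/seteqP; split=> [b [Ab /= eb]|b ->//].
    exact: einj (mem_set Ab) (mem_set Aa) (etrans eb (esym ea)).
  rewrite esum_set1// (@eq_measure_integral _ _ _ _ (dirac a)).
    by rewrite integral_dirac// diracT mul1e.
  move=> B _ _; rewrite /= /point_measure diracE.
  have [Ba|nBa] := pselect (B a).
    by rewrite mem_set// setIidl ?esum_set1// => _ ->.
  rewrite memNset// (_ : _ `&` _ = set0) ?esum_set0//.
  by apply/seteqP; split=> // b [->].
move=> B _ _; rewrite /= /mseries /point_measure AD setI_bigcupl esum_bigcupT//.
  by rewrite nneseries_esumT// => n; exact: esum_ge0.
apply/trivIsetP => i j _ _ ij; move/trivIsetP: tD => /(_ i j Logic.I Logic.I ij).
by move=> Dij; rewrite (setIACA (D i)) Dij set0I.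
Qed.

End point_measure.

(** * Measurability of sums over the atoms of a configuration *)

Section config_measurability.
Context (R : realType) (d : nat) (K : ptopologicalType).
Local Notation Y := ('rV[R]_d * K)%type.
Implicit Types (phi : config R d K).

(** Sorting the atoms by the integer part of the norm of their location cuts a
   configuration into countably many finite groups. *)
Definition annulus (n : nat) : set Y := [set a | Num.truncn `|a.1|%R = n].

Lemma measurable_annulus n : measurable (annulus n : set (borel Y)).
Proof.
have mnorm : measurable_fun setT (fun a : borel Y => `|a.1|%R : borel R).
  apply: (@measurable_continuous Y R (fun a => `|a.1|%R)) => a.
  apply: (@continuous_comp Y 'rV[R]_d R fst Num.norm); first exact: cvg_fst.
  exact: norm_continuous.
have -> : annulus n = (fun a : borel Y => `|a.1|%R : borel R) @^-1`
    ([set x | n%:R <= x]%R `&` [set x | x < n.+1%:R]%R).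
  apply/seteqP; split=> a /=; rewrite /annulus/=.
    by move=> <-; apply/andP; exact: truncn_itv.
  by move=> /andP h; apply/truncn_def.
rewrite -[X in measurable X]setTI; apply: mnorm => //; apply: measurableI.
  by apply: (@measurable_closed R); exact: closed_ge.
by apply: (@measurable_open R); exact: open_lt.
Qed.

Lemma bounded_annulus n : bounded_set (fst @` annulus n).
Proof.
exists n.+1%:R; split=> // r nr _ [a an <-] /=; apply: ltW; apply: lt_trans nr.
by rewrite -an; exact: truncnS_gt.
Qed.

Lemma countable_atoms phi : countable (atoms phi).
Proof.
have -> : atoms phi = \bigcup_n (atoms phi `&` ((fst @` annulus n) `*` setT)).
  apply/seteqP; split=> [a pa|a [n _ []]//].
  by exists (Num.truncn `|a.1|%R) => //; split=> //; split=> //=; exists a.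
apply: bigcup_countable => // n _; apply: finite_set_countable.
exact/config_locally_finite/bounded_annulus.
Qed.

Lemma evaluationE (B : set (borel Y)) phi :
  evaluation B phi = point_measure R (atoms phi : set (borel Y)) B.
Proof. exact: counting_esum. Qed.

Lemma measurable_evaluation (B : set (borel Y)) : measurable B ->
  measurable_fun setT (@evaluation R d K B).
Proof.
move=> mB _ Z mZ; rewrite setTI; apply: sub_sigma_algebra.
by exists B, Z.
Qed.

Lemma measurable_config dX (X : measurableType dX) (u : X -> config R d K) :
  (forall B : set (borel Y), measurable B ->
    measurable_fun setT (fun x => evaluation B (u x))) ->
  measurable_fun setT u.
Proof.
move=> mu; apply: (@measurability _ _ _ _ _ _ (@evaluation_sets R d K)) => //.
by move=> _ [_ [B [Z [mB mZ ->]] <-]]; rewrite -comp_preimage; exact: mu.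
Qed.

Section esum_atoms.
Import HBNNSimple.
Context dX (X : measurableType dX) (u : X -> config R d K).
Hypothesis u_measurable : measurable_fun setT u.

Definition atom_kernel (x : X) : {measure set (borel Y) -> \bar R} :=
  point_measure R (atoms (u x) : set (borel Y)).

Let measurable_atom_kernel U :
  measurable U -> measurable_fun setT (atom_kernel ^~ U).
Proof.
move=> mU; rewrite [X in measurable_fun _ X](_ : _ = evaluation U \o u).
  by apply: measurableT_comp => //; exact: measurable_evaluation.
by apply/funext => x /=; rewrite evaluationE.
Qed.

HB.instance Definition _ := isKernel.Build _ _ _ _ _ atom_kernel
  measurable_atom_kernel.

(** The monotone class argument for sections asks for finite measures.  An
   annulus carries finitely many atoms, and the annuli are then summed. *)
Lemma measurable_xsection_atom_kernel (A : set (X * borel Y)) : measurable A ->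
  measurable_fun setT (fun x => atom_kernel x (xsection A x)).
Proof.
move=> mA.
rewrite (_ : (fun x => _) = (fun x => \sum_(n <oo)
   mrestr (atom_kernel x) (measurable_annulus n) (xsection A x))).
  apply: ge0_emeasurable_sum => // n _.
  have [] := @measurable_prod_subset_xsection_kernel _ _ _ _ _ atom_kernel _
    (measurable_annulus n) _ A mA => //.
  move=> x; have finA : finite_set (atoms (u x) `&` annulus n).
    apply: sub_finite_set (config_locally_finite (u x) (bounded_annulus n)).
    by move=> a [ua na]; split=> //; split=> //; exists a.
  exists (#|` fset_set (atoms (u x) `&` annulus n)|%:R + 1)%R => B mB.
  apply: (@le_lt_trans _ _ (point_measure R (atoms (u x) :
    set (borel Y)) (annulus n))).
    apply: le_measure; last exact: subIsetr.
      by apply: mem_set; apply: measurableI => //; exact: measurable_annulus.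
    by apply: mem_set; exact: measurable_annulus.
  rewrite /point_measure -counting_esum /counting asboolT// lte_fin.
  by rewrite ltrDl.
apply/funext => x; rewrite /mrestr /= /point_measure.
transitivity (\esum_(a in \bigcup_n (atoms (u x) `&` (xsection A x `&` annulus
  n))) (1 : \bar R)).
  congr (esum _ _); apply/seteqP; split=> [a [ua Aa]|a [n _ [ua [Aa _]]]//].
  by exists (Num.truncn `|a.1|%R).
rewrite esum_bigcupT//.
  by rewrite nneseries_esumT// => n; exact: esum_ge0.
by move=> i j _ _ [a [[_ [_ <-]] [_ [_ <-]]]].
Qed.

(** The evaluation sigma-algebra gives the number of atoms in a fixed Borel
   set.  This extends it to sums of functions that also depend on a parameter,
   and all measurability statements about configurations follow from it. *)
Lemma measurable_esum_atoms (g : X * borel Y -> \bar R) :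
  (forall z, 0 <= g z) -> measurable_fun setT g ->
  measurable_fun setT (fun x => \esum_(a in atoms (u x)) g (x, a)).
Proof.
move=> g0 mg.
rewrite (_ : (fun x => _) = (fun x => \int[atom_kernel x]_a g (x, a))).
  apply: (@measurable_fun_xsection_integral _ _ _ _ _ g atom_kernel
    (nnsfun_approx measurableT mg)).
  - by move=> a b ab; exact/nd_nnsfun_approx.
  - by move=> z; exact/cvg_nnsfun_approx.
  - by move=> n r; apply: measurable_xsection_atom_kernel.
apply/funext => x; rewrite integral_point_measure//.
  exact: countable_atoms.
exact: measurableT_comp.
Qed.
End esum_atoms.
End config_measurability.

(** * Shifting configurations and forgetting marks *)

Section config_transformations.
Context (R : realType) (d : nat).

Lemma config_ext (K : ptopologicalType) (phi psi : config R d K) :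
  atoms phi = atoms psi -> phi = psi.
Proof.
case: phi psi => [A fA oA] [B fB oB] /= AB; subst B.
by congr Config; exact: Prop_irrelevance.
Qed.

Lemma shift_shift (K : ptopologicalType) (y z : 'rV[R]_d) (phi : config R d K) :
  shift z (shift y phi) = shift (y + z)%R phi.
Proof.
apply: config_ext => /=; rewrite image_comp; congr image; apply/funext => a /=.
by rewrite opprD addrA.
Qed.

Lemma forget_shift (M M' : ptopologicalType) (y : 'rV[R]_d)
  (psi : config R d (M * M')%type) : forget (shift y psi) = shift y (forget psi).
Proof. by apply: config_ext; rewrite /= !image_comp. Qed.

Lemma at_origin_shift (K : ptopologicalType) (phi : config R d K) a :
  atoms phi a -> at_origin (shift a.1 phi).
Proof.
by move=> pa; exists (a.1 - a.1, a.2)%R; [exists a|exact: subrr].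
Qed.

Lemma esum_atoms_shift (K : ptopologicalType) (y : 'rV[R]_d) (phi : config R d K)
    (g : 'rV[R]_d * K -> \bar R) :
  \esum_(b in atoms (shift y phi)) g b =
  \esum_(a in atoms phi) g (a.1 - y, a.2)%R.
Proof.
rewrite esum_image// => -[x m] [x' m'] _ _ /= [xx' ->].
by rewrite (addIr _ xx').
Qed.

(** A location carries one mark, hence forgetting does not merge atoms. *)
Lemma esum_atoms_forget (M M' : ptopologicalType)
    (psi : config R d (M * M')%type) (g : 'rV[R]_d * M -> \bar R) :
  \esum_(b in atoms (forget psi)) g b =
  \esum_(a in atoms psi) g (a.1, a.2.1).
Proof.
rewrite esum_image// => -[x m] [x' m'] /set_mem/= xm /set_mem/= xm' [xx' _].
by subst x'; congr (_, _); exact: config_one_mark xm xm'.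
Qed.

Lemma esum_locations (K : ptopologicalType) (phi : config R d K) (C : set 'rV[R]_d)
    (g : 'rV[R]_d -> \bar R) :
  \esum_(x in locations phi `&` C) g x =
  \esum_(a in atoms phi) (\1_C a.1)%:E * g a.1.
Proof.
rewrite esum_mkcondr esum_image; last first.
  move=> -[x m] [x' m'] /set_mem/= xm /set_mem/= xm' /= xx'.
  by subst x'; congr (_, _); exact: config_one_mark xm xm'.
by apply: eq_esum => a _; rewrite indicE; case: ifP; rewrite ?mul1e ?mul0e.
Qed.

Lemma evaluation_esum (K : ptopologicalType) (B : set ('rV[R]_d * K))
    (phi : config R d K) :
  evaluation B phi = \esum_(a in atoms phi) (\1_B a)%:E.
Proof.
rewrite /evaluation counting_esum esum_mkcondr.
by apply: eq_esum => a _; rewrite indicE; case: ifP.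
Qed.

Lemma borel_fst (K : ptopologicalType) :
  measurable_fun setT (fst : borel ('rV[R]_d * K)%type -> borel 'rV[R]_d).
Proof. by apply: measurable_continuous => a; exact: cvg_fst. Qed.

Lemma measurable_indicE dT (T : measurableType dT) (B : set T) :
  measurable B -> measurable_fun setT (fun x => (\1_B x)%:E : \bar R).
Proof. by move=> mB; apply/measurable_EFinP; exact: measurable_indic. Qed.

(** The number of atoms of the shifted configuration in [B] is the sum of
   1_B(a.1 - y, a.2) over the atoms a of the original one, which is measurable
   in the pair of the vector and the configuration. *)
Lemma measurable_shift (K : ptopologicalType) :
  measurable_fun setT (fun p : borel 'rV[R]_d * config R d K => shift p.1 p.2).
Proof.
apply: measurable_config => B mB.
rewrite [X in measurable_fun _ X](_ : _ = fun p : borel 'rV[R]_d * config R d K =>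
   \esum_(a in atoms p.2) (\1_B (a.1 - p.1, a.2)%R)%:E); last first.
  by apply/funext => p; rewrite evaluation_esum esum_atoms_shift.
apply: (@measurable_esum_atoms _ _ _ _ _ snd _
  (fun z : (borel 'rV[R]_d * config R d K) * borel ('rV[R]_d * K)%type =>
    (\1_B (z.2.1 - z.1.1, z.2.2)%R)%:E)) => //.
apply: (@measurableT_comp _ _ _ _ _ _ (fun b => (\1_B b)%:E));
  first exact: measurable_indicE.
apply: (@measurableT_comp _ _ _ _ _ _
  (fun q : borel 'rV[R]_d * borel ('rV[R]_d * K)%type => (q.2.1 - q.1, q.2.2)%R :
    borel ('rV[R]_d * K)%type)
  _ (fun z : (borel 'rV[R]_d * config R d K) * borel ('rV[R]_d * K)%type =>
    (z.1.1, z.2))).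
  apply: (@measurable_continuous_prod
    'rV[R]_d ('rV[R]_d * K)%type ('rV[R]_d * K)%type
    (fun q => (q.2.1 - q.1, q.2.2)%R)).
    exact: (@second_countable_rV R d).
  have c21 : continuous (fun q : 'rV[R]_d * ('rV[R]_d * K) => q.2.1).
    exact: continuous_compT (@continuous_snd _ _) (@continuous_fst _ _).
  apply: continuous_pair.
    move=> q; apply: (@cvgB R 'rV[R]_d); first exact: c21.
    exact: continuous_fst.
  exact: continuous_compT (@continuous_snd _ _) (@continuous_snd _ _).
apply: measurable_fun_pair => //.
exact: measurableT_comp.
Qed.

Lemma measurable_shift_comp (K : ptopologicalType) dX (X : measurableType dX)
    (v : X -> borel 'rV[R]_d) (u : X -> config R d K) :
  measurable_fun setT v -> measurable_fun setT u ->
  measurable_fun setT (fun x => shift (v x) (u x)).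
Proof.
move=> mv mu.
exact: (measurableT_comp (@measurable_shift K) (measurable_fun_pair mv mu)).
Qed.

Lemma measurable_forget (M M' : ptopologicalType) :
  measurable_fun setT (@forget R d M M').
Proof.
apply: measurable_config => B mB.
rewrite [X in measurable_fun _ X](_ : _ = fun psi : config R d (M * M')%type =>
   \esum_(a in atoms psi) (\1_B (a.1, a.2.1))%:E); last first.
  by apply/funext => p; rewrite evaluation_esum esum_atoms_forget.
apply: (@measurable_esum_atoms _ _ _ _ _ id _
  (fun z : config R d (M * M')%type * borel ('rV[R]_d * (M * M'))%type =>
    (\1_B (z.2.1, z.2.2.1))%:E)) => //.
apply: (@measurableT_comp _ _ _ _ _ _ (fun b => (\1_B b)%:E));
  first exact: measurable_indicE.
apply: (@measurableT_comp _ _ _ _ _ _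
  (fun q : borel ('rV[R]_d * (M * M'))%type => (q.1, q.2.1) :
    borel ('rV[R]_d * M)%type)
  _ snd) => //.
apply: (@measurable_continuous ('rV[R]_d * (M * M'))%type ('rV[R]_d * M)%type
  (fun q => (q.1, q.2.1))).
apply: continuous_pair; first exact: continuous_fst.
exact: continuous_compT (@continuous_snd _ _) (@continuous_fst _ _).
Qed.

End config_transformations.

(** * Sums of nonnegative extended reals *)

Section esum_complements.
Context (R : realType).

Lemma esum_exchange (T1 T2 : choiceType) (I : set T1) (J : set T2)
    (a : T1 -> T2 -> \bar R) :
  (forall i j, 0 <= a i j) ->
  \esum_(i in I) \esum_(j in J) a i j = \esum_(j in J) \esum_(i in I) a i j.
Proof.
move=> a0; rewrite esum_esum// esum_esum//.
rewrite (reindex_esum (J `*` I) _ (fun x => (x.2, x.1)))//.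
split=> //=.
- by move=> [j i] [].
- by move=> [j i] [j' i'] _ _ [-> ->].
- by move=> [i j] /= [Ii Jj]; exists (j, i).
Qed.

Lemma esum_indicl (T1 T2 : choiceType) (U : set T1) x (J : set T2)
    (a : T2 -> \bar R) :
  \esum_(j in J) (\1_U x)%:E * a j = (\1_U x)%:E * \esum_(j in J) a j.
Proof.
rewrite indicE; case: (x \in U); first by rewrite mul1e; apply: eq_esum => j _;
  rewrite mul1e.
by rewrite mul0e; apply: esum1 => j _; rewrite mul0e.
Qed.

Lemma subset_esum (T : choiceType) (A B : set T) (a : T -> \bar R) :
  (forall i, 0 <= a i) -> A `<=` B -> \esum_(i in A) a i <= \esum_(i in B) a i.
Proof.
move=> a0 AB; rewrite esum_mkcond [leRHS]esum_mkcond; apply: le_esum => i _.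
case: ifPn => [/set_mem /AB Bi|_]; first by rewrite mem_set.
by case: ifP.
Qed.

Lemma nneseries_cst_lty (e : \bar R) : 0 <= e -> \sum_(i <oo) e < +oo -> e = 0.
Proof.
case: e => [r|_|//]; last by rewrite (@nneseries_pinfty _ _ _ 0).
rewrite lee_fin => r0; rewrite -[X in limn X](_ :
  (fun n => \sum_(0 <= i < n) (r%:E * 1)) = _); last first.
  by apply/funext => n; apply: eq_bigr => i _; rewrite mule1.
rewrite nneseriesZl// nneseries_esumT// -counting_esum /counting asboolF;
  last exact: infinite_nat.
have [->//|rn0] := eqVneq r 0%R.
by rewrite gt0_muley// lte_fin lt_def rn0.
Qed.

Lemma esum_eq0 (T : choiceType) (A : set T) (a : T -> \bar R) :
  (forall i, 0 <= a i) -> \esum_(i in A) a i = 0 -> forall i, A i -> a i = 0.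
Proof.
move=> a0 sa0 i Ai; apply/eqP; rewrite eq_le a0 andbT -sa0.
apply: esum_ge; exists [set i]; first by split=> [|_ ->]; [exact: finite_set1|].
by rewrite fsbig_set1.
Qed.

Lemma esum_single (T : choiceType) (A : set T) (a : T -> \bar R) i :
  A i -> 0 <= a i -> (forall j, A j -> j != i -> a j = 0) ->
  \esum_(j in A) a j = a i.
Proof.
move=> Ai ai0 aj0; have <- : \esum_(j in [set i]) a j = a i by exact: esum_set1.
rewrite esum_mkcond [RHS]esum_mkcond; apply: eq_esum => j _.
have [->|ji] := eqVneq j i; first by rewrite mem_set// in_set1 eqxx.
rewrite in_set1 (negbTE ji); case: ifPn => // /set_mem Aj; exact: aj0.
Qed.

Lemma esum_countType (T : countType) (a : T -> \bar R) : (forall k, 0 <= a k) ->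
  \esum_(k in [set: T]) a k = \sum_(n <oo) oapp a 0 (pickle_inv n).
Proof.
move=> a0.
rewrite nneseries_esumT; last by move=> n; case: (pickle_inv n).
have -> : \esum_(k in [set: T]) a k =
   \esum_(n in choice.pickle @` [set: T]) oapp a 0 (pickle_inv n).
  rewrite esum_image; last by move=> x y _ _; exact: (pcan_inj (@choice.pickleK T)).
  by apply: eq_esum => k _; rewrite pickleK_inv.
rewrite esum_mkcond; apply: eq_esum => n _; case: ifPn => // /negP nP.
case E : (pickle_inv n) => [k|]//=; exfalso; apply: nP; apply: mem_set.
by exists k => //; have := @choice.pickle_invK T n; rewrite E.
Qed.

Lemma integral_esum (T : countType) dX (X : measurableType dX)
    (mu : {measure set X -> \bar R}) (F : T -> X -> \bar R) :
  (forall k, measurable_fun setT (F k)) -> (forall k x, 0 <= F k x) ->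
  \int[mu]_x (\esum_(k in [set: T]) F k x) =
  \esum_(k in [set: T]) (\int[mu]_x F k x).
Proof.
move=> mF F0; rewrite esum_countType; last by move=> k; apply: integral_ge0.
under eq_integral do rewrite esum_countType//.
rewrite integral_nneseries//.
- apply: eq_eseriesr => n _; case: (pickle_inv n) => //=.
  by rewrite integral0.
- by move=> n; case: (pickle_inv n).
- by move=> n x _; case: (pickle_inv n) => /=.
Qed.

End esum_complements.

Lemma measurable_esum_locations (R : realType) (d : nat) (K : ptopologicalType)
    dX (X : measurableType dX) (u : X -> config R d K)
    (C : set (borel 'rV[R]_d)) (g : X * borel 'rV[R]_d -> \bar R) :
  measurable_fun setT u -> measurable C -> (forall z, 0 <= g z) ->
  measurable_fun setT g ->
  measurable_fun setT (fun x => \esum_(y in locations (u x) `&` C) g (x, y)).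
Proof.
move=> mu mC g0 mg.
rewrite [X in measurable_fun _ X](_ :
  _ = (fun x => \esum_(a in atoms (u x)) ((\1_C a.1)%:E * g (x, a.1)))); last first.
  by apply/funext => x; rewrite esum_locations.
apply: (@measurable_esum_atoms _ _ _ _ _ u mu
  (fun z : X * borel ('rV[R]_d * K)%type =>
    (\1_C z.2.1)%:E * g (z.1, z.2.1))).
  by move=> z; rewrite mule_ge0// lee_fin.
apply: emeasurable_funM.
  apply: (@measurableT_comp _ _ _ _ _ _ (fun b => (\1_C b)%:E));
    first exact: measurable_indicE.
  by apply: measurableT_comp => //; exact: borel_fst.
apply: (@measurableT_comp _ _ _ _ _ _ g _
  (fun z : X * borel ('rV[R]_d * K)%type => (z.1, z.2.1))) => //.
apply: measurable_fun_pair => //.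
by apply: measurableT_comp => //; exact: borel_fst.
Qed.

(** * Mass transport between the points of a stationary process *)

Section cells.
Context (R : realType) (d : nat).
Local Notation V := 'rV[R]_d.

Definition half_open_cube : set V := [set x | forall j, 0 <= x ord0 j < 1]%R.

Definition lattice_vector (k : 'rV[int]_d) : V := map_mx intr k.

Definition cell (k : 'rV[int]_d) : set V :=
  [set x | half_open_cube (x - lattice_vector k)%R].

Lemma lattice_vectorN k : lattice_vector (- k)%R = (- lattice_vector k)%R.
Proof. by apply/rowP => j; rewrite !mxE intrN. Qed.

(** The cells tile the space: a point lies in the cell of its integer parts. *)
Lemma cell_floor x k : cell k x <-> k = (\row_j Num.floor (x ord0 j))%R.
Proof.
split=> [kx|->].
  apply/rowP => j; rewrite mxE; apply/esym/floor_def.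
  by have := kx j; rewrite !mxE subr_ge0 ltrBlDl intrD.
by move=> j; rewrite !mxE subr_ge0 ltrBlDl -intrD1 floor_itv.
Qed.

Lemma esum_cell x (v : \bar R) : 0 <= v ->
  \esum_(k in [set: 'rV[int]_d]) ((\1_(cell k) x)%:E * v) = v.
Proof.
move=> v0; pose k : 'rV[int]_d := (\row_j Num.floor (x ord0 j))%R.
rewrite (@esum_single _ _ _ _ k)//=.
- by rewrite indicE mem_set ?mul1e//; apply/cell_floor.
- by rewrite mule_ge0// lee_fin.
- by move=> l _ /eqP lk; rewrite indicE memNset ?mul0e// => /cell_floor.
Qed.

Lemma esum_cellN x (v : \bar R) : 0 <= v ->
  \esum_(k in [set: 'rV[int]_d]) ((\1_(cell (- k)%R) x)%:E * v) = v.
Proof.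
move=> v0; apply: etrans (esum_cell x v0); apply/esym.
apply: (reindex_esum setT setT (fun k : 'rV[int]_d => - k)%R).
by split.
Qed.

Lemma measurable_coordinate j : measurable_fun setT ((fun x => x ord0 j) :
  borel V -> borel R).
Proof. by apply: measurable_continuous; exact: coord_continuous. Qed.

Lemma measurable_half_open_cube : measurable (half_open_cube : set (borel V)).
Proof.
have -> : half_open_cube = \bigcap_(j in [set: 'I_d])
    ((fun x : borel V => x ord0 j : borel R) @^-1`
       ([set x | 0 <= x]%R `&` [set x | x < 1]%R)).
  apply/seteqP; split=> [x Cx j _ /=|x Cx j]; first exact/andP/Cx.
  by apply/andP; exact: (Cx j).
apply: fin_bigcap_measurable => // j _.
rewrite -[X in measurable X]setTI; apply: measurable_coordinate => //.
apply: measurableI.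
  by apply: (@measurable_closed R); exact: closed_ge.
by apply: (@measurable_open R); exact: open_lt.
Qed.

Lemma measurable_unit_cube : measurable (@unit_cube R d : set (borel V)).
Proof.
have -> : @unit_cube R d = \bigcap_(j in [set: 'I_d])
    ((fun x : borel V => x ord0 j : borel R) @^-1`
       ([set x | 0 <= x]%R `&` [set x | x <= 1]%R)).
  apply/seteqP; split=> [x Cx j _ /=|x Cx j]; first exact/andP/Cx.
  by apply/andP; exact: (Cx j).
apply: fin_bigcap_measurable => // j _.
rewrite -[X in measurable X]setTI; apply: measurable_coordinate => //.
apply: measurableI; apply: (@measurable_closed R).
  exact: closed_ge.
exact: closed_le.
Qed.

Lemma measurable_translate (y : V) (B : set (borel V)) : measurable B ->
  measurable ([set x | B (x - y)%R] : set (borel V)).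
Proof.
move=> mB; rewrite (_ : [set x | _] = (fun x : borel V => (x - y)%R :
  borel V) @^-1` B)//.
rewrite -[X in measurable X]setTI;
  apply: (@measurable_continuous V V (fun x => x - y)%R) => //.
by move=> x; apply: (@cvgB R V V (nbhs x) _ id (cst y) x y);
  [exact: cvg_id|exact: cvg_cst].
Qed.

End cells.

Section mass_transport.
Context (R : realType) (d : nat) (K : ptopologicalType).
Local Notation Y := ('rV[R]_d * K)%type.
Variable Q : {measure set (config R d K) -> \bar R}.
Hypothesis statQ : stationary Q.

Lemma measurable_shift1 (y : 'rV[R]_d) : measurable_fun setT (@shift R d K y).
Proof.
apply: (@measurableT_comp _ _ _ _ _ _
  (fun p : borel 'rV[R]_d * config R d K => shift p.1 p.2) _ (pair y)).
  exact: measurable_shift.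
exact: measurable_fun_pair.
Qed.

Lemma integral_shift (y : 'rV[R]_d) (F : config R d K -> \bar R) :
  (forall psi, 0 <= F psi) -> measurable_fun setT F ->
  \int[Q]_psi F (shift y psi) = \int[Q]_psi F psi.
Proof.
move=> F0 mF; have my := measurable_shift1 y.
rewrite -[LHS](@ge0_integral_pushforward _ _ _ _ _ _ my Q setT F)//.
by apply: eq_measure_integral => A mA _; exact: statQ.
Qed.

Variable h : (config R d K * borel Y) * borel Y -> \bar R.
Hypothesis h0 : forall z, 0 <= h z.
Hypothesis mh : measurable_fun setT h.
Hypothesis h_shift : forall (y : 'rV[R]_d) psi (a b : Y),
  h (shift y psi, (a.1 - y, a.2), (b.1 - y, b.2))%R = h (psi, a, b).

Let pair_sum (U V : set 'rV[R]_d) (psi : config R d K) : \bar R :=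
  \esum_(a in atoms psi) \esum_(b in atoms psi)
    ((\1_U a.1)%:E * ((\1_V b.1)%:E * h (psi, a, b))).

Let pair_sum_ge0 U V psi : 0 <= pair_sum U V psi.
Proof.
by apply: esum_ge0 => a _; apply: esum_ge0 => b _; rewrite !mule_ge0// lee_fin.
Qed.

Let measurable_pair_sum (U V : set (borel 'rV[R]_d)) :
  measurable U -> measurable V -> measurable_fun setT (pair_sum U V).
Proof.
move=> mU mV.
apply: (@measurable_esum_atoms _ _ _ _ _ id _ (fun z : config R d K * borel Y =>
  \esum_(b in atoms z.1)
    ((\1_U z.2.1)%:E * ((\1_V b.1)%:E * h (z, b))))) => //.
  by move=> z; apply: esum_ge0 => b _; rewrite !mule_ge0// lee_fin.
apply: (@measurable_esum_atoms _ _ _ _ _ fst _ (fun w :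
  (config R d K * borel Y) * borel Y =>
  ((\1_U w.1.2.1)%:E * ((\1_V w.2.1)%:E * h w)))) => //.
  by move=> w; rewrite !mule_ge0// lee_fin.
apply: emeasurable_funM; last apply: emeasurable_funM => //.
  apply: (@measurableT_comp _ _ _ _ _ _ (fun b => (\1_U b)%:E));
    first exact: measurable_indicE.
  apply: measurableT_comp; first exact: borel_fst.
  exact: measurableT_comp.
apply: (@measurableT_comp _ _ _ _ _ _ (fun b => (\1_V b)%:E));
  first exact: measurable_indicE.
by apply: measurableT_comp; first exact: borel_fst.
Qed.

Let pair_sum_shift (U V : set 'rV[R]_d) y psi : pair_sum U V (shift y psi) =
  pair_sum [set x | U (x - y)%R] [set x | V (x - y)%R] psi.
Proof.
rewrite /pair_sum esum_atoms_shift; apply: eq_esum => a _.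
by rewrite esum_atoms_shift; apply: eq_esum => b _; rewrite h_shift.
Qed.

Let C := @half_open_cube R d.

(** The points of the cube send as much mass on average as they receive.  The
   receivers [b] are sorted by the cell that contains them.  A shift by the
   lattice vector of the cell moves the receiver to the cube and the giver [a]
   from the cube to the opposite cell, and it preserves the law; summing over
   the cells leaves the giver arbitrary. *)
Lemma mass_transport :
  \int[Q]_psi (\esum_(a in atoms psi) ((\1_C a.1)%:E * \esum_(b in atoms psi) h
    (psi, a, b))) =
  \int[Q]_psi (\esum_(b in atoms psi) ((\1_C b.1)%:E * \esum_(a in atoms psi) h
    (psi, a, b))).
Proof.
have mC : measurable (C : set (borel 'rV[R]_d)) by exact: measurable_half_open_cube.
have mcell k : measurable (@cell R d k : set (borel 'rV[R]_d)).
  exact: measurable_translate.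
transitivity (\int[Q]_psi (\esum_(k in [set: 'rV[int]_d]) pair_sum C (cell k) psi)).
  apply: eq_integral => psi _; rewrite /pair_sum esum_exchange; last first.
    by move=> k a; apply: esum_ge0 => b _; rewrite !mule_ge0// lee_fin.
  apply: eq_esum => a _; rewrite esum_exchange; last first.
    by move=> k b; rewrite !mule_ge0// lee_fin.
  rewrite -esum_indicl; apply: eq_esum => b _.
  by rewrite esum_indicl esum_cell.
rewrite integral_esum//; last by move=> k; exact: measurable_pair_sum.
transitivity (\esum_(k in [set: 'rV[int]_d])
    (\int[Q]_psi (pair_sum (cell (- k)%R) C psi))).
  apply: eq_esum => k _.
  apply: etrans (esym (integral_shift (- lattice_vector R k)%R
    (pair_sum_ge0 C (cell k)) (measurable_pair_sum mC (mcell k)))) _.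
  apply: eq_integral => psi _.
  have E1 : [set x | C (x - - lattice_vector R k)%R] = cell (- k)%R.
    by rewrite /cell lattice_vectorN.
  have E2 : [set x | cell k (x - - lattice_vector R k)%R] = C.
    by apply/funext => x; rewrite /cell /= opprK addrK.
  by rewrite (pair_sum_shift C (cell k) (- lattice_vector R k)%R psi) E1 E2.
rewrite -integral_esum//; last by move=> k; exact: measurable_pair_sum.
have h0' (U V : set 'rV[R]_d) psi a b :
    0 <= (\1_U a.1)%:E * ((\1_V b.1)%:E * h (psi, a, b)).
  by rewrite !mule_ge0// lee_fin.
apply: eq_integral => psi _; rewrite /pair_sum.
rewrite -esum_exchange; last by move=> a k; exact: esum_ge0.
under eq_esum do rewrite -esum_exchange//.
transitivity (\esum_(a in atoms psi) \esum_(b in atoms psi)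
    ((\1_C b.1)%:E * h (psi, a, b))).
  by do 2!apply: eq_esum => ? _; rewrite esum_cellN// mule_ge0// lee_fin.
rewrite esum_exchange; last by move=> a b; rewrite mule_ge0// lee_fin.
by apply: eq_esum => b _; rewrite esum_indicl.
Qed.

End mass_transport.

(** * Absence of points on the boundary of the unit cube *)

Section unit_cube_boundary.
Context (R : realType) (d : nat) (K : ptopologicalType).
Local Notation Y := ('rV[R]_d * K)%type.
Variable Q : {measure set (config R d K) -> \bar R}.
Hypothesis statQ : stationary Q.

Lemma evaluation_ge0 (B : set Y) (psi : config R d K) : 0 <= evaluation B psi.
Proof. by rewrite /evaluation counting_esum; exact: esum_ge0. Qed.

Lemma evaluation_eq0 (B : set Y) (psi : config R d K) :
  evaluation B psi = 0 -> atoms psi `&` B = set0.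
Proof.
rewrite /evaluation counting_esum => e0; apply/seteqP; split=> // a aB.
by have /eqP := esum_eq0 (fun _ => lee01) e0 aB; rewrite onee_eq0.
Qed.

Lemma ae_no_atom (B : set (borel Y)) : measurable B ->
  \int[Q]_psi evaluation B psi = 0 ->
  {ae Q, forall psi, atoms psi `&` B = set0}.
Proof.
move=> mB I0; have : ae_eq Q setT (evaluation B) (cst 0).
  apply/ae_eq_integral_abs => //; first exact: measurable_evaluation.
  by rewrite -[RHS]I0; apply: eq_integral => psi _;
    rewrite gee0_abs// evaluation_ge0.
by apply: filterS => psi /(_ Logic.I) /evaluation_eq0.
Qed.

Lemma measurable_cylinder (B : set (borel 'rV[R]_d)) : measurable B ->
  measurable (B `*` setT : set (borel Y)).
Proof.
move=> mB; rewrite (_ : B `*` setT = (fst : borel Y -> borel 'rV[R]_d) @^-1` B).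
  by rewrite -[X in measurable X]setTI; exact: borel_fst.
by apply/seteqP; split=> [a []|a].
Qed.

Lemma measurable_evaluation_cylinder (B : set (borel 'rV[R]_d)) : measurable B ->
  measurable_fun setT (fun psi : config R d K => evaluation (B `*` setT) psi).
Proof. by move=> mB; apply: measurable_evaluation; exact: measurable_cylinder. Qed.

Lemma evaluation_cylinder_shift (B : set 'rV[R]_d) y (psi : config R d K) :
  evaluation (B `*` setT) (shift y psi) =
  evaluation ([set x | B (x - y)%R] `*` setT) psi.
Proof.
rewrite evaluation_esum esum_atoms_shift evaluation_esum.
by apply: eq_esum => a _; rewrite !indicE; congr ((_ : bool)%:R%:E);
  apply/asboolP/asboolP.
Qed.

Let face j : set 'rV[R]_d := [set x | unit_cube x /\ x ord0 j = 1%R].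

Let measurable_face j : measurable (face j : set (borel 'rV[R]_d)).
Proof.
apply: measurableI; first exact: measurable_unit_cube.
have := measurable_coordinate j measurableT (@measurable_closed R _ (@closed_eq R
  1%R)).
by rewrite setTI.
Qed.

Hypothesis finQ : intensity Q < +oo.

(** The translates of a face by -1/(i+1) along its normal are disjoint, lie in
   the cube and have the same expected number of points.  As infinitely many of
   them share a finite intensity, this number is 0. *)
Let face_intensity j : \int[Q]_psi evaluation (face j `*` setT) psi = 0.
Proof.
set e := LHS; have e0 : 0 <= e by apply: integral_ge0 => psi _;
  exact: evaluation_ge0.
pose y (i : nat) : 'rV[R]_d := (- (i.+1%:R^-1 *: delta_mx ord0 j))%R.
pose T i := [set x | face j (x - y i)%R].
have mT i : measurable (T i : set (borel 'rV[R]_d)) by exact: measurable_translate.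
have eT i : \int[Q]_psi evaluation (T i `*` setT) psi = e.
  rewrite /e -(integral_shift statQ (y i) (fun psi =>
    evaluation_ge0 (face j `*` setT) psi)
    (measurable_evaluation_cylinder (measurable_face j))).
  by apply: eq_integral => psi _; rewrite evaluation_cylinder_shift.
have : \sum_(i <oo) e <= intensity Q.
  rewrite (_ : \sum_(i <oo) e =
    \sum_(i <oo) \int[Q]_psi evaluation (T i `*` setT) psi); last first.
    by apply: eq_eseriesr => i _; rewrite eT.
  rewrite -integral_nneseries//; last 2 first.
  - by move=> i; apply: measurable_evaluation_cylinder; exact: mT.
  - by move=> i psi _; exact: evaluation_ge0.
  apply: ge0_le_integral => //.
  - by move=> psi _; apply: nneseries_ge0 => i _ _; exact: evaluation_ge0.
  - apply: ge0_emeasurable_sum => [i psi _ _|i _]; first exact: evaluation_ge0.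
    exact: measurable_evaluation_cylinder (mT i).
  - exact: measurable_evaluation_cylinder (@measurable_unit_cube R d).
  move=> psi _; rewrite /evaluation counting_esum nneseries_esumT; last first.
    by move=> i; rewrite counting_esum; exact: esum_ge0.
  under eq_esum do rewrite counting_esum.
  rewrite -esum_bigcupT//; last first.
    move=> i1 i2 _ _ [a [[_ [[_ E1] _]] [_ [[_ E2] _]]]].
    have : ((i1.+1%:R : R)^-1 = i2.+1%:R^-1)%R.
      by have := etrans E1 (esym E2); rewrite !mxE !eqxx !mulr1 !opprK => /addrI.
    by move=> /invr_inj/eqP; rewrite eqr_nat eqSS => /eqP.
  apply: subset_esum => // a [i _ [psia [[Ca Ej] _]]]; split=> //; split=> // l.
  have := Ca l; move: Ej; rewrite !mxE !eqxx mulr1 !opprK.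
  have [->|lj] := eqVneq l j; last by rewrite mulr0 addr0.
  move=> /eqP; rewrite eq_sym -subr_eq => /eqP <- _.
  rewrite subr_ge0 invf_le1// ler1n /= lerBlDl lerDr invr_ge0 ler0n.
  by [].
move=> /le_lt_trans /(_ finQ); exact: nneseries_cst_lty.
Qed.

(** The closed cube enters the definitions of intensities and of the Palm
   measure, the half-open one tiles the space; they differ by the faces. *)
Lemma ae_half_open_cube :
  {ae Q, forall psi, locations psi `&` @unit_cube R d =
    locations psi `&` @half_open_cube R d}.
Proof.
have : {ae Q, forall psi, forall j, atoms psi `&` (face j `*` setT) = set0}.
  apply: filter_forall => j.
  apply: ae_no_atom; last exact: face_intensity.
  exact: measurable_cylinder (measurable_face j).
apply: filterS => psi noface; apply/seteqP; split=> x [px Cx]; split => // j.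
  case/andP: (Cx j) => -> xj1; rewrite lt_neqAle xj1 andbT; apply/eqP => xj.
  case: px => a psia ax; suff :
    (atoms psi `&` (face j `*` setT)) a by rewrite noface.
  by split=> //; split=> //; rewrite ax; split.
by case/andP: (Cx j) => -> /ltW ->.
Qed.

End unit_cube_boundary.

(** * Integration against a mixture of measures *)

Section mixture.
Context (R : realType) dX dY dZ (X : measurableType dX) (Y : measurableType dY)
  (Z : measurableType dZ).
Variables (mu : {measure set X -> \bar R}) (k : X -> {measure set Y -> \bar R})
  (T : X -> Y -> Z) (nu : {measure set Z -> \bar R}).
Hypothesis mT : forall x, measurable_fun setT (T x).
Hypothesis mk : forall g : Z -> \bar R, (forall z, 0 <= g z) ->
  measurable_fun setT g -> measurable_fun setT (fun x => \int[k x]_y g (T x y)).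
Hypothesis nuE : forall A, measurable A ->
  nu A = \int[mu]_x \int[k x]_y (\1_A (T x y))%:E.

Import HBNNSimple.

Let integral_mixture_nnsfun (f : {nnsfun Z >-> R}) :
  \int[nu]_z (f z)%:E = \int[mu]_x \int[k x]_y (f (T x y))%:E.
Proof.
have mf r : measurable (f @^-1` [set r]) by exact: measurable_sfunP.
have m1 r : measurable_fun setT (fun z => (\1_(f @^-1` [set r]) z)%:E : \bar R).
  exact: measurable_indicE.
have ge0 r z : 0 <= r%:E * (\1_(f @^-1` [set r]) z)%:E :> \bar R.
  by rewrite nnfun_muleindic_ge0.
have I0 r x : 0 <= \int[k x]_y (\1_(f @^-1` [set r]) (T x y))%:E.
  by apply: integral_ge0 => y _; rewrite lee_fin.
have mI r : measurable_fun setT (fun x =>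
  \int[k x]_y (\1_(f @^-1` [set r]) (T x y))%:E).
  by apply: (mk _ (m1 r)) => z; rewrite lee_fin.
have Zl r x : \int[k x]_y (r%:E * (\1_(f @^-1` [set r]) (T x y))%:E) =
    r%:E * \int[k x]_y (\1_(f @^-1` [set r]) (T x y))%:E.
  have [r0|r0] := leP 0%R r.
    by rewrite ge0_integralZl//; exact: measurableT_comp (m1 r) (mT x).
  rewrite integral0_eq => [|y _]; last by rewrite preimage_nnfun0// indic0 mule0.
  by rewrite integral0_eq ?mule0// => y _; rewrite preimage_nnfun0// indic0.
transitivity (\int[mu]_x \sum_(r \in range f)
    (r%:E * \int[k x]_y (\1_(f @^-1` [set r]) (T x y))%:E)); last first.
  apply: eq_integral => x _.
  under [RHS]eq_integral do rewrite fimfunE -fsumEFin//.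
  rewrite ge0_integral_fsum//.
  - by apply: eq_fsbigr => r _; rewrite -Zl; apply: eq_integral => y _;
      rewrite EFinM.
  - move=> r; rewrite (_ : (fun _ => _) = (fun y =>
      r%:E * (\1_(f @^-1` [set r]) (T x y))%:E)).
      by apply: measurable_funeM; exact: measurableT_comp (m1 r) (mT x).
    by apply/funext => y; rewrite EFinM.
  - by move=> r y _; rewrite EFinM.
rewrite integralT_nnsfun sintegralE ge0_integral_fsum//.
- apply: eq_fsbigr => r _; rewrite nuE//.
  have [r0|r0] := leP 0%R r.
    by rewrite ge0_integralZl//; exact: mI.
  rewrite integral0_eq ?mule0; last first.
    by move=> x _; rewrite integral0_eq// => y _; rewrite preimage_nnfun0// indic0.
  rewrite integral0_eq// => x _.
  by rewrite integral0_eq ?mule0// => y _; rewrite preimage_nnfun0// indic0.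
- by move=> r; apply: measurable_funeM; exact: mI.
- by move=> r x _; rewrite -Zl; apply: integral_ge0.
Qed.

(** The identity that defines [nu] on measurable sets extends to nonnegative
   functions by simple functions and monotone convergence.  For the Palm
   measure, [k] counts the points in the cube and [T] shifts them to the
   origin, and this is the refined Campbell formula. *)
Lemma integral_mixture (g : Z -> \bar R) : (forall z, 0 <= g z) ->
  measurable_fun setT g ->
  \int[nu]_z g z = \int[mu]_x \int[k x]_y g (T x y).
Proof.
move=> g0 mg; pose f_ := nnsfun_approx measurableT mg.
have mf_ n : measurable_fun setT (EFin \o f_ n) by exact/measurable_EFinP.
have nd z : {homo (fun n => (f_ n z)%:E) : a b / (a <= b)%N >-> a <= b}.
  by move=> a b ab; rewrite lee_fin; exact/lefP/nd_nnsfun_approx.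
have lim_ z : limn (fun n => (f_ n z)%:E) = g z.
  by apply/cvg_lim => //; exact: cvg_nnsfun_approx.
transitivity (\int[nu]_z limn (fun n => (f_ n z)%:E)).
  by apply: eq_integral => z _; rewrite lim_.
rewrite monotone_convergence//; last by move=> n z _; rewrite lee_fin.
rewrite (_ : (fun _ => _) = (fun n =>
  \int[mu]_x (\int[k x]_y (f_ n (T x y))%:E))); last first.
  by apply/funext => n; rewrite integral_mixture_nnsfun.
rewrite -monotone_convergence//.
- apply: eq_integral => x _; rewrite -monotone_convergence//.
  + by apply: eq_integral => y _; rewrite lim_.
  + by move=> n; exact: measurableT_comp (mf_ n) (mT x).
  + by move=> n y _; rewrite lee_fin.
- by move=> n; apply: (mk _ (mf_ n)) => z; rewrite /= lee_fin.
- by move=> n x _; apply: integral_ge0 => y _; rewrite lee_fin.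
- move=> x _ a b ab; apply: ge0_le_integral => //.
  + by move=> y _; rewrite lee_fin.
  + exact: measurableT_comp (mf_ a) (mT x).
  + exact: measurableT_comp (mf_ b) (mT x).
  + by move=> y _; exact: nd.
Qed.

End mixture.

(** * The Palm measure *)

Section palm_measure.
Context (R : realType) (d : nat) (K : ptopologicalType).
Local Notation Y := ('rV[R]_d * K)%type.

Definition cube_sum (g : config R d K -> \bar R) (phi : config R d K) : \bar R :=
  \esum_(x in locations phi `&` @unit_cube R d) g (shift x phi).

Lemma cube_sum_ge0 g phi : (forall phi, 0 <= g phi) -> 0 <= cube_sum g phi.
Proof. by move=> g0; apply: esum_ge0. Qed.

Lemma measurable_cube_sum g : (forall phi, 0 <= g phi) ->
  measurable_fun setT g -> measurable_fun setT (cube_sum g).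
Proof.
move=> g0 mg.
apply: (@measurable_esum_locations _ _ _ _ _ id (@unit_cube R d)
  (fun z : config R d K * borel 'rV[R]_d => g (shift z.2 z.1))) => //.
  exact: measurable_unit_cube.
apply: measurableT_comp => //.
exact: measurable_shift_comp.
Qed.

Variable Q : {measure set (config R d K) -> \bar R}.

(** The Palm measure before the division by the intensity, hence a measure
   whatever the value of the intensity. *)
Definition campbell_measure (A : set (config R d K)) : \bar R :=
  \int[Q]_phi cube_sum (fun phi' => (\1_A phi')%:E) phi.

Let indic_ge0 (A : set (config R d K)) phi : 0 <= (\1_A phi)%:E :> \bar R.
Proof. by rewrite lee_fin. Qed.

Let campbell0 : campbell_measure set0 = 0.
Proof.
apply: integral0_eq => phi _; apply: esum1 => x _.
by rewrite indic0.
Qed.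

Let campbell_ge0 A : 0 <= campbell_measure A.
Proof. by apply: integral_ge0 => phi _; apply: cube_sum_ge0. Qed.

Let campbell_sigma_additive : semi_sigma_additive campbell_measure.
Proof.
move=> F mF tF mU.
rewrite [X in _ --> X](_ : _ = \sum_(0 <= i <oo) campbell_measure (F i)).
  by apply: is_cvg_nneseries => n _ _; exact: campbell_ge0.
rewrite -integral_nneseries//; last 2 first.
- move=> n; apply: measurable_cube_sum => //; exact: measurable_indicE.
- by move=> n phi _; exact: cube_sum_ge0.
apply: eq_integral => phi _; rewrite nneseries_esumT; last first.
  by move=> n; exact: cube_sum_ge0.
rewrite /cube_sum esum_exchange//; apply: eq_esum => x _.
have [[n _ Fn]|nF] := pselect ((\bigcup_n F n) (shift x phi)).
  rewrite indicE mem_set; last by exists n.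
  rewrite (@esum_single _ _ _ _ n)//= ?indicE ?mem_set//.
  move=> j _ jn; rewrite indicE memNset// => Fj; move/eqP: jn; apply.
  by apply: tF => //; exists (shift x phi).
rewrite indicE memNset// esum1// => n _; rewrite indicE memNset// => Fn.
by apply: nF; exists n.
Qed.

HB.instance Definition _ := isMeasure.Build _ _ _ campbell_measure
  campbell0 campbell_ge0 campbell_sigma_additive.

Lemma cube_sum_atoms g phi : (forall phi, 0 <= g phi) ->
  cube_sum g phi =
  \esum_(a in atoms phi `&` (@unit_cube R d `*` setT)) g (shift a.1 phi).
Proof.
move=> g0; rewrite /cube_sum esum_locations esum_mkcondr.
apply: eq_esum => a _; rewrite indicE.
have [Ca|Ca] := pselect (unit_cube a.1).
  by rewrite !mem_set// mul1e.
by rewrite !memNset ?mul0e// => -[].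
Qed.

(** Given the configuration, the sum over its points in the cube is an integral
   against a point measure, so that [integral_mixture] applies. *)
Lemma integral_campbell_measure g : (forall phi, 0 <= g phi) ->
  measurable_fun setT g ->
  \int[campbell_measure]_phi g phi = \int[Q]_phi cube_sum g phi.
Proof.
pose k (phi : config R d K) : {measure set (borel Y) -> \bar R} :=
  point_measure R (atoms phi `&` (@unit_cube R d `*` setT) : set (borel Y)).
have mS phi : measurable_fun setT (fun a : borel Y => shift a.1 phi).
  by apply: measurable_shift_comp => //; exact: borel_fst.
have kE g' phi : (forall phi, 0 <= g' phi) -> measurable_fun setT g' ->
    \int[k phi]_a g' (shift a.1 phi) = cube_sum g' phi.
  move=> g'0 mg'; rewrite integral_point_measure//.
  - by rewrite cube_sum_atoms.
  - by apply: sub_countable (countable_atoms phi); apply: subset_card_le;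
      exact: subIsetl.
  - exact: measurableT_comp.
move=> g0 mg; rewrite (@integral_mixture _ _ _ _ _ _ _ Q k (fun phi a =>
  shift a.1 phi))//.
- by apply: eq_integral => phi _; rewrite kE.
- move=> g' g'0 mg'; rewrite (_ : (fun _ => _) = cube_sum g').
    exact: measurable_cube_sum.
  by apply/funext => phi; exact: kE.
- move=> A mA; apply: eq_integral => phi _.
  by rewrite (kE (fun z => (\1_A z)%:E))//; exact: measurable_indicE.
Qed.

Hypothesis Q_intensity : 0 < intensity Q < +oo.

Lemma intensity_fin : (fine (intensity Q))%:E = intensity Q.
Proof. by case/andP: Q_intensity => l0 l1; rewrite fineK// ge0_fin_numE// ltW. Qed.

Lemma fine_intensity_gt0 : (0 < fine (intensity Q))%R.
Proof. by rewrite -lte_fin intensity_fin; case/andP: Q_intensity. Qed.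

Lemma inv_intensity_ge0 : (0 <= (fine (intensity Q))^-1)%R.
Proof. by rewrite invr_ge0 ltW// fine_intensity_gt0. Qed.

Definition palm_measure : {measure set (config R d K) -> \bar R} :=
  mscale (NngNum inv_intensity_ge0) campbell_measure.

Lemma palmE : palm Q = palm_measure.
Proof.
apply/funext => A; rewrite /palm /palm_measure /= /mscale /=; congr (_ * _).
by rewrite -[in LHS]intensity_fin inver gt_eqF// fine_intensity_gt0.
Qed.

Lemma intensity_mul_palm g : (forall phi, 0 <= g phi) -> measurable_fun setT g ->
  intensity Q * \int[palm_measure]_phi g phi = \int[Q]_phi cube_sum g phi.
Proof.
move=> g0 mg; rewrite ge0_integral_mscale//= integral_campbell_measure//.
rewrite -intensity_fin muleA -EFinM divff ?mul1e// gt_eqF//.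
exact: fine_intensity_gt0.
Qed.

Lemma palm_measureT : palm_measure setT = 1.
Proof.
rewrite /palm_measure /= /mscale /= /campbell_measure.
rewrite (_ : \int[Q]_phi _ = intensity Q).
  rewrite -[X in _ * X]intensity_fin -EFinM mulVf// gt_eqF//.
  exact: fine_intensity_gt0.
apply: eq_integral => phi _; rewrite cube_sum_atoms// /evaluation counting_esum.
by apply: eq_esum => a _; rewrite indicT.
Qed.

End palm_measure.

(** * Sums and expectations of quantities given by two parts *)

Section signed_pairs.
Context (R : realType).
Implicit Types (p n : \bar R).

(** The pair stands for the quantity [p - n], in one of the two classes of
   values that the score may have: for [c = true] the class of [0, +oo] and
   -oo, where [n = +oo] overrides [p], and for [c = false] the class of
   [-oo, 0].  The condition that [p] or [n] vanishes is not stable under sums,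
   whereas each class is ([signed_esum]). *)
Definition signed (c : bool) p n : Prop :=
  [/\ 0 <= p, 0 <= n & if c then n = 0 \/ n = +oo else p = 0].

Lemma signed_neg c p n : signed c p n -> maxe (- (p - n)) 0 = n.
Proof.
case=> p0 n0; case: c => [[->|->]|->].
- by rewrite sube0; apply/max_idPr; rewrite oppe_le0.
- by rewrite addeNy /=; apply/max_idPl; rewrite leey.
- by rewrite sub0e oppeK; apply/max_idPl.
Qed.

Lemma signed_pos c p n : signed c p n -> n != +oo -> maxe (p - n) 0 = p.
Proof.
case=> p0 n0; case: c => [[->|->]|->] nfin.
- by rewrite sube0; apply/max_idPl.
- by rewrite eqxx in nfin.
- by rewrite sub0e; apply/max_idPr; rewrite oppe_le0.
Qed.

Lemma signed_maxe c x : (if c then 0 <= x \/ x = -oo else x <= 0) ->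
  signed c (maxe x 0) (maxe (- x) 0).
Proof.
move=> cx; split; rewrite ?le_max ?lexx ?orbT//.
case: c cx => [[x0|->]|x0]; last exact/max_idPr.
  by left; apply/max_idPr; rewrite oppe_le0.
by right; apply/max_idPl; rewrite leey.
Qed.

Lemma signed_sub c p n : signed c p n ->
  if c then 0 <= p - n \/ p - n = -oo else p - n <= 0.
Proof.
case: c => -[p0 n0] => [[->|->]|->].
- by left; rewrite sube0.
- by right; rewrite addeNy.
- by rewrite sub0e oppe_le0.
Qed.

Lemma maxe_sub (x : \bar R) : maxe x 0 - maxe (- x) 0 = x.
Proof.
have [x0|x0] := orP (le_total 0 x).
  by rewrite (max_idPl x0) (max_idPr _) ?sube0// oppe_le0.
by rewrite (max_idPr x0) (max_idPl _) ?sub0e ?oppeK// oppe_ge0.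
Qed.

(** If a term is -oo, then the negative parts sum to +oo, and the difference of
   extended reals is -oo as soon as +oo is subtracted. *)
Lemma esumNyE (I : choiceType) (A : set I) (a : I -> \bar R) :
  esumNy A a = \esum_(i in A) maxe (a i) 0 - \esum_(i in A) maxe (- a i) 0.
Proof.
have E : esumNy A a = if `[< exists2 i, A i & a i = -oo >] then -oo else
    \esum_(i in A) maxe (a i) 0 - \esum_(i in A) maxe (- a i) 0.
  rewrite /esumNy; case: ifP => // _.
  by congr (_ - _); apply: eq_esum => i _; rewrite ?funeposE ?funenegE.
rewrite {}E; case: asboolP => // -[i Ai aiN].
rewrite [X in _ - X](_ : _ = +oo) ?addeNy//; apply/eqP; rewrite -leye_eq.
rewrite (@le_trans _ _ (\esum_(j in [set i]) maxe (- a j) 0))//.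
  rewrite esum_set1 ?aiN; first exact: lexx.
  exact: leey.
by apply: subset_esum => [j|j ->//]; rewrite le_max lexx orbT.
Qed.

Lemma signed_esum c (I : choiceType) (A : set I) (p n : I -> \bar R) :
  (forall i, A i -> signed c (p i) (n i)) ->
  signed c (\esum_(i in A) p i) (\esum_(i in A) n i).
Proof.
move=> s; split; try by apply: esum_ge0 => i /s[].
case: c s => s; last by apply: esum1 => i /s[].
have [[i Ai ni]|h] := pselect (exists2 i, A i & n i = +oo).
  right; apply/eqP; rewrite -leye_eq -ni.
  apply: esum_ge; exists [set i]; first by split=> [|_ ->].
  by rewrite fsbig_set1.
left; apply: esum1 => i Ai; case: (s i Ai) => _ _ [//|ni].
by exfalso; apply: h; exists i.
Qed.

(** [p i] can differ from the positive part of [p i - n i] only if [n i = +oo],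
   and then both sides are -oo. *)
Lemma esumNy_signed c (I : choiceType) (A : set I) (a p n : I -> \bar R) :
  (forall i, A i -> a i = p i - n i) ->
  (forall i, A i -> signed c (p i) (n i)) ->
  esumNy A a = \esum_(i in A) p i - \esum_(i in A) n i.
Proof.
move=> apn s; rewrite esumNyE.
rewrite [X in _ - X](_ : _ = \esum_(i in A) n i); last first.
  by apply: eq_esum => i Ai; rewrite apn//; exact: signed_neg (s i Ai).
have [->|nfin] := eqVneq (\esum_(i in A) n i) +oo; first by rewrite !addeNy.
congr (_ - _); apply: eq_esum => i Ai; rewrite apn//.
apply: signed_pos (s i Ai) _; apply: contra nfin => /eqP ni.
rewrite -leye_eq -ni; apply: esum_ge; exists [set i]; first by split=> [|_ ->].
by rewrite fsbig_set1.
Qed.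

Section expectation.
Context dX (X : measurableType dX) (Q : {measure set X -> \bar R}).

Lemma measurable_maxe0 (g : X -> \bar R) : measurable_fun setT g ->
  measurable_fun setT (fun x => maxe (g x) 0).
Proof.
move=> mg; rewrite [X in measurable_fun _ X](_ : _ = g^\+).
  exact: measurable_funepos.
by apply/funext => x; rewrite funeposE.
Qed.

Lemma measurable_maxeN0 (g : X -> \bar R) : measurable_fun setT g ->
  measurable_fun setT (fun x => maxe (- g x) 0).
Proof.
move=> mg; rewrite [X in measurable_fun _ X](_ : _ = g^\-).
  exact: measurable_funeneg.
by apply/funext => x; rewrite funenegE.
Qed.

Lemma ae_lty (g : X -> \bar R) : (forall x, 0 <= g x) -> measurable_fun setT g ->
  \int[Q]_x g x != +oo -> {ae Q, forall x, g x != +oo}.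
Proof.
move=> g0 mg Ig; have /integrable_ae : Q.-integrable setT g.
  apply/integrableP; split=> //; under eq_integral do rewrite gee0_abs//.
  by rewrite ltey.
by move=> /(_ measurableT); apply: filterS => x /(_ Logic.I); case: (g x).
Qed.

(** If -oo is a value of positive probability, then the negative part has
   integral +oo. *)
Lemma expectNyE (g : X -> \bar R) : measurable_fun setT g ->
  expectNy Q g = \int[Q]_x maxe (g x) 0 - \int[Q]_x maxe (- g x) 0.
Proof.
move=> mg; rewrite /expectNy; case: asboolP => h.
  by rewrite integralE; congr (_ - _); apply: eq_integral => x _;
    rewrite ?funeposE ?funenegE.
have [->|fin] := eqVneq (\int[Q]_x maxe (- g x) 0) +oo; first by rewrite addeNy.
exfalso; apply: h; have : {ae Q, forall x, maxe (- g x) 0 != +oo}.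
  apply: ae_lty => //; first by move=> x; rewrite le_max lexx orbT.
  exact: measurable_maxeN0.
apply: filterS => x; apply: contra_neq_not => -> /=.
by apply/max_idPl; rewrite leey.
Qed.

(** The counterpart of [esumNy_signed] for expectations, where [n] is +oo either
   on a null set or with positive probability. *)
Lemma expectNy_signed c (g p n : X -> \bar R) :
  measurable_fun setT p -> measurable_fun setT n ->
  (forall x, g x = p x - n x) -> (forall x, signed c (p x) (n x)) ->
  expectNy Q g = \int[Q]_x p x - \int[Q]_x n x.
Proof.
move=> mp mn gpn s; have -> : g = (fun x => p x - n x) by apply/funext.
rewrite expectNyE; last exact: emeasurable_funB.
rewrite [X in _ - X](_ : _ = \int[Q]_x n x); last first.
  by apply: eq_integral => x _; exact: signed_neg (s x).
have [->|nfin] := eqVneq (\int[Q]_x n x) +oo; first by rewrite !addeNy.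
congr (_ - _); apply: ge0_ae_eq_integral => //.
- by apply: measurable_maxe0; exact: emeasurable_funB.
- by move=> x _; rewrite le_max lexx orbT.
- by move=> x _; case: (s x).
have : {ae Q, forall x, n x != +oo} by apply: ae_lty => // x; case: (s x).
by apply: filterS => x nx _; exact: signed_pos (s x) nx.
Qed.

Import HBNNSimple.

Let le_integral_off_null (f g : X -> \bar R) (N : set X) :
  (forall x, 0 <= f x) -> (forall x, 0 <= g x) ->
  measurable N -> Q N = 0 -> (forall x, ~ N x -> f x = g x) ->
  \int[Q]_x f x <= \int[Q]_x g x.
Proof.
move=> f0 g0 mN QN fg; rewrite ge0_integralTE// (ge0_integralTE _ g0).
apply: ge_ereal_sup => _ [h /= hf <-]; apply: ereal_sup_ubound.
exists (proj_nnsfun h (measurableC mN)).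
  move=> x /=; rewrite mindicE; have [Nx|Nx] := pselect (N x).
    by rewrite memNset ?mulr0//=; case.
  by rewrite mem_set// mulr1 -fg.
rewrite -!integralT_nnsfun; apply: ge0_ae_eq_integral => //.
- exact/measurable_EFinP.
- exact/measurable_EFinP.
- by move=> x _; rewrite lee_fin.
- by move=> x _; rewrite lee_fin.
exists N; split=> // x /= /not_implyP[_]; apply: contra_notP => Nx.
by rewrite /= mindicE mem_set// mulr1.
Qed.

(** Meant for a function [f] without measurability, such as the supremum of an
   uncountable family.  Its integral is a supremum over simple functions, which
   may be replaced by 0 on the null set. *)
Lemma expectNy_off_null (f g : X -> \bar R) (N : set X) :
  measurable N -> Q N = 0 -> (forall x, ~ N x -> f x = g x) ->
  expectNy Q f = expectNy Q g.
Proof.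
move=> mN QN fg.
have E (f1 g1 : X -> \bar R) : (forall x, 0 <= f1 x) -> (forall x, 0 <= g1 x) ->
    (forall x, ~ N x -> f1 x = g1 x) -> \int[Q]_x f1 x = \int[Q]_x g1 x.
  move=> f0 g0 fg1; apply/eqP; rewrite eq_le; apply/andP.
  by split; apply: (le_integral_off_null _ _ mN) => // x Nx; rewrite fg1.
have aeN : {ae Q, forall x, ~ N x} by exists N; split=> // x /= /contrapT.
rewrite /expectNy [X in if `[< X >] then _ else _](_ :
  _ = {ae Q, forall t, g t <> -oo}); last first.
  by apply/propext; split; apply: filterS2 aeN => x Nx; rewrite fg.
case: ifP => // _; rewrite integralE [RHS]integralE.
by congr (_ - _); apply: E => x //; rewrite ?funeposE ?funenegE => Nx; rewrite fg.
Qed.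

End expectation.
End signed_pairs.

(** * Score intensities as sums over the receiving points *)

Lemma measurable_subV (R : realType) (d : nat) dX (X : measurableType dX)
    (u v : X -> borel 'rV[R]_d) :
  measurable_fun setT u -> measurable_fun setT v ->
  measurable_fun setT (fun x => (u x - v x)%R : borel 'rV[R]_d).
Proof.
move=> mu mv; have msub : measurable_fun setT
    (fun p : borel 'rV[R]_d * borel 'rV[R]_d => (p.1 - p.2)%R : borel 'rV[R]_d).
  apply: (@measurable_continuous_prod 'rV[R]_d 'rV[R]_d 'rV[R]_d (fun p =>
    p.1 - p.2)%R).
    exact: (@second_countable_rV R d).
  by move=> p; apply: (@cvgB R 'rV[R]_d _ (nbhs p) _ fst snd p.1 p.2);
    [exact: cvg_fst|exact: cvg_snd].
exact: (measurableT_comp msub (measurable_fun_pair mu mv)).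
Qed.

Section score_formula.
Context (R : realType) (d : nat) (M M' : ptopologicalType).
Local Notation V := 'rV[R]_d.
Local Notation Y := (V * (M * M'))%type.
Local Notation base := (config R d M).
Local Notation marked := (config R d (M * M')%type).

Section transport.
Variable Q : {measure set marked -> \bar R}.
Hypothesis statQ : stationary Q.
Hypothesis finQ : intensity Q < +oo.

Definition in_unit_cube (x : V) : \bar R := (\1_(@unit_cube R d) x)%:E.

Lemma measurable_esum_cube (C : set (borel V)) (g : marked * borel Y -> \bar R) :
  measurable C -> (forall z, 0 <= g z) -> measurable_fun setT g ->
  measurable_fun setT
    (fun psi => \esum_(a in atoms psi) ((\1_C a.1)%:E * g (psi, a))).
Proof.
move=> mC g0 mg; apply: (@measurable_esum_atoms _ _ _ _ _ id _
  (fun z : marked * borel Y => (\1_C z.2.1)%:E * g z)) => //.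
  by move=> z; rewrite mule_ge0// lee_fin.
apply: emeasurable_funM => //.
exact: (measurableT_comp (measurable_indicE mC) (measurableT_comp (@borel_fst R d
  _) measurable_snd)).
Qed.

(** Allows one to apply [mass_transport], which is about the half-open cube, to
   sums over the closed cube. *)
Lemma integral_esum_cube (g : marked * borel Y -> \bar R) :
  (forall z, 0 <= g z) -> measurable_fun setT g ->
  \int[Q]_psi (\esum_(a in atoms psi) (in_unit_cube a.1 * g (psi, a))) =
  \int[Q]_psi (\esum_(a in atoms psi)
    ((\1_(@half_open_cube R d) a.1)%:E * g (psi, a))).
Proof.
move=> g0 mg; apply: ge0_ae_eq_integral => //.
- exact: measurable_esum_cube (@measurable_unit_cube R d) g0 mg.
- exact: measurable_esum_cube (@measurable_half_open_cube R d) g0 mg.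
- by move=> psi _; apply: esum_ge0 => a _; rewrite mule_ge0// lee_fin.
- by move=> psi _; apply: esum_ge0 => a _; rewrite mule_ge0// lee_fin.
apply: filterS (ae_half_open_cube statQ finQ) => psi E _.
apply: eq_esum => a psia; rewrite /in_unit_cube !indicE.
have la : locations psi a.1 by exists a.
have : (locations psi `&` @unit_cube R d) a.1 <-> (locations psi `&`
  @half_open_cube R d) a.1.
  by rewrite E.
have [Ca|Ca] := pselect (unit_cube a.1);
  have [Da|Da] := pselect (half_open_cube a.1).
- by rewrite !mem_set.
- by case=> /(_ (conj la Ca)) [].
- by case=> _ /(_ (conj la Da)) [].
- by rewrite !memNset.
Qed.

Variable G : borel V * borel M' * base -> \bar R.
Hypothesis G0 : forall z, 0 <= G z.
Hypothesis mG : measurable_fun setT G.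

Let h (z : (marked * borel Y) * borel Y) : \bar R :=
  G ((z.2.1 - z.1.2.1)%R, z.2.2.2, shift z.2.1 (forget z.1.1)).

Let mh : measurable_fun setT h.
Proof.
have mb1 : measurable_fun setT
    (fun z : (marked * borel Y) * borel Y => z.2.1 : borel V).
  exact: (measurableT_comp (@borel_fst R d _) measurable_snd).
have ma1 : measurable_fun setT
    (fun z : (marked * borel Y) * borel Y => z.1.2.1 : borel V).
  exact: (measurableT_comp (@borel_fst R d _) (measurableT_comp measurable_snd
    measurable_fst)).
have mb22 : measurable_fun setT
    (fun z : (marked * borel Y) * borel Y => z.2.2.2 : borel M').
  apply: (@measurableT_comp _ _ _ _ _ _
    (fun b : borel Y => b.2.2 : borel M') _ snd) => //.
  apply: (@measurable_continuous Y M' (fun b => b.2.2)).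
  exact: continuous_compT (@continuous_snd _ _) (@continuous_snd _ _).
have mf : measurable_fun setT
    (fun z : (marked * borel Y) * borel Y => forget z.1.1).
  exact: (measurableT_comp (@measurable_forget R d M M') (measurableT_comp
    measurable_fst measurable_fst)).
exact: (measurableT_comp mG (measurable_fun_pair
  (measurable_fun_pair (measurable_subV mb1 ma1) mb22) (measurable_shift_comp mb1
    mf))).
Qed.

(** [mass_transport] for the mass G(b - a, m'_b, S_b Phi) exchanged by two
   atoms a and b.  From b the atom a is seen at a - b, so that the sum over a
   becomes a sum over the locations of S_b Phi. *)
Lemma transport_pair_score :
  \int[Q]_psi (\esum_(x in locations psi `&` @unit_cube R d)
    \esum_(b in atoms (shift x psi)) G (b.1, b.2.2,
      shift b.1 (forget (shift x psi)))) =
  \int[Q]_psi (\esum_(b in atoms psi) (in_unit_cube b.1 *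
    \esum_(y in locations (shift b.1 (forget psi))) G ((- y)%R, b.2.2,
      shift b.1 (forget psi)))).
Proof.
have h0 z : 0 <= h z by exact: G0.
have mhl : measurable_fun setT
    (fun z : marked * borel Y => \esum_(b in atoms z.1) h (z, b)).
  exact: (@measurable_esum_atoms _ _ _ _ _ fst _ h).
have mhr : measurable_fun setT
    (fun z : marked * borel Y => \esum_(a in atoms z.1) h ((z.1, a), z.2)).
  apply: (@measurable_esum_atoms _ _ _ _ _ fst _
    (fun w : (marked * borel Y) * borel Y => h ((w.1.1, w.2), w.1.2))) => //.
  apply: measurableT_comp mh _; apply: measurable_fun_pair.
    apply: measurable_fun_pair => //.
    exact: measurableT_comp.
  exact: measurableT_comp.
transitivity (\int[Q]_psi (\esum_(a in atoms psi) (in_unit_cube a.1 * \esum_(b in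
  atoms psi) h (psi, a, b)))).
  apply: eq_integral => psi _; rewrite esum_locations; apply: eq_esum => a _.
  congr (_ * _); rewrite esum_atoms_shift; apply: eq_esum => b _.
  by rewrite /h /= forget_shift shift_shift subrKC.
apply: etrans (integral_esum_cube _ mhl) _; first by move=> z; exact: esum_ge0.
apply: etrans (mass_transport statQ h0 mh _) _.
  move=> y psi a b; rewrite /h /= forget_shift shift_shift.
  by rewrite subrKC opprB addrA subrK.
apply: etrans (esym (integral_esum_cube _ mhr)) _; first by move=> z;
  exact: esum_ge0.
apply: eq_integral => psi _; apply: eq_esum => b _; congr (_ * _).
rewrite -[locations _]setIT esum_locations esum_atoms_shift esum_atoms_forget.
by apply: eq_esum => a _; rewrite indicT mul1e /h /= opprB.
Qed.

End transport.
End score_formula.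

Section mark_sums.
Context (R : realType) (d : nat) (M M' : ptopologicalType).
Local Notation V := 'rV[R]_d.
Local Notation Y := (V * (M * M'))%type.
Local Notation base := (config R d M).
Local Notation marked := (config R d (M * M')%type).

Lemma measurable_mark_shift : measurable_fun setT
  (fun z : marked * borel Y =>
    (z.2.2.2 : borel M', shift z.2.1 (forget z.1))).
Proof.
apply: measurable_fun_pair.
  apply: (@measurableT_comp _ _ _ _ _ _
    (fun b : borel Y => b.2.2 : borel M') _ snd) => //.
  apply: (@measurable_continuous Y M' (fun b => b.2.2)).
  exact: continuous_compT (@continuous_snd _ _) (@continuous_snd _ _).
apply: measurable_shift_comp.
  exact: (measurableT_comp (@borel_fst R d _) measurable_snd).
exact: (measurableT_comp (@measurable_forget R d M M') measurable_fst).
Qed.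

Lemma measurable_mark_sum (g : borel M' * base -> \bar R) :
  (forall z, 0 <= g z) -> measurable_fun setT g ->
  measurable_fun setT (fun psi : marked =>
    \esum_(b in atoms psi) (in_unit_cube b.1 * g (b.2.2, shift b.1 (forget psi)))).
Proof.
move=> g0 mg; apply: (@measurable_esum_cube R d M M' _
  (fun z : marked * borel Y => g (z.2.2.2, shift z.2.1 (forget z.1)))
  (@measurable_unit_cube R d) (fun z => g0 _)).
exact: (measurableT_comp mg measurable_mark_shift).
Qed.

End mark_sums.

Section signed_score.
Context (R : realType) (d : nat) (M M' : ptopologicalType).
Local Notation V := 'rV[R]_d.
Local Notation Y := (V * (M * M'))%type.
Local Notation base := (config R d M).
Local Notation marked := (config R d (M * M')%type).
Variables (c : bool) (H : V -> M' -> base -> \bar R).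
Hypothesis mH : measurable_fun setT
  (fun p : borel V * borel M' * base => H p.1.1 p.1.2 p.2).
Hypothesis cH : forall x m' phi,
  if c then 0 <= H x m' phi \/ H x m' phi = -oo else H x m' phi <= 0.

Let HP (z : borel V * borel M' * base) := maxe (H z.1.1 z.1.2 z.2) 0.
Let HN (z : borel V * borel M' * base) := maxe (- H z.1.1 z.1.2 z.2) 0.

Let mHP : measurable_fun setT HP. Proof. exact: measurable_maxe0. Qed.
Let mHN : measurable_fun setT HN. Proof. exact: measurable_maxeN0. Qed.
Let HP0 z : 0 <= HP z. Proof. by rewrite /HP le_max lexx orbT. Qed.
Let HN0 z : 0 <= HN z. Proof. by rewrite /HN le_max lexx orbT. Qed.
Let sH z : signed c (HP z) (HN z). Proof. exact/signed_maxe/cH. Qed.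
Let HPN x m' phi : H x m' phi = HP (x, m', phi) - HN (x, m', phi).
Proof. by rewrite /HP /HN maxe_sub. Qed.

Let transported (G : borel V * borel M' * base -> \bar R) (z : borel M' * base) :=
  \esum_(y in locations z.2) G ((- y)%R, z.1, z.2).

Let measurable_transported (G : borel V * borel M' * base -> \bar R) :
  (forall z, 0 <= G z) -> measurable_fun setT G ->
  measurable_fun setT (transported G).
Proof.
move=> G0 mG; rewrite [X in measurable_fun _ X](_ : _ = fun z =>
   \esum_(y in locations z.2 `&` setT) G ((- y)%R, z.1, z.2)); last first.
  by apply/funext => z; rewrite setIT.
apply: (@measurable_esum_locations _ _ _ _ _ snd setT
  (fun w : (borel M' * base) * borel V => G ((- w.2)%R, w.1.1, w.1.2))) => //.
have mopp : measurable_fun setT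
    (fun w : (borel M' * base) * borel V => (- w.2)%R : borel V).
  rewrite [X in measurable_fun _ X](_ : _ =
      fun w : (borel M' * base) * borel V => (0 - w.2)%R : borel V).
    by apply: measurable_subV; [exact: measurable_cst|exact: measurable_snd].
  by apply/funext => w; rewrite sub0r.
exact: (measurableT_comp mG (measurable_fun_pair
  (measurable_fun_pair mopp (measurableT_comp measurable_fst measurable_fst))
  (measurableT_comp measurable_snd measurable_fst))).
Qed.

Let transported_scoreE m' phi : transported_score H m' phi =
  transported HP (m', phi) - transported HN (m', phi).
Proof. exact: (esumNy_signed (fun y _ => HPN (- y)%R m' phi) (fun y _ =>
  sH _)). Qed.

Let signed_transported z : signed c (transported HP z) (transported HN z).
Proof. by apply: signed_esum => y _; exact: sH. Qed.

Lemma measurable_transported_score : measurable_fun setT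
  (fun z : borel M' * base => transported_score H z.1 z.2).
Proof.
rewrite [X in measurable_fun _ X](_ :
  _ = fun z => transported HP z - transported HN z).
  by apply: emeasurable_funB; exact: measurable_transported.
by apply/funext => -[m' phi]; rewrite transported_scoreE.
Qed.

Lemma transported_score_sign m' phi : if c then
  0 <= transported_score H m' phi \/ transported_score H m' phi = -oo
  else transported_score H m' phi <= 0.
Proof. by rewrite transported_scoreE; exact: signed_sub (signed_transported _). Qed.

Variable Q : {measure set marked -> \bar R}.
Hypothesis statQ : stationary Q.
Hypothesis finQ : intensity Q < +oo.

Let f (psi : marked) (b : Y) :=
  transported_score H b.2.2 (shift b.1 (forget psi)).

(** The positive and the negative part of [H] are nonnegative, and
   [transport_pair_score] applies to each of them.  The results are the two
   parts of [f] in the sense of [signed], and since sums and expectations do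
   not depend on the pair that represents a signed quantity, they can be
   replaced by the actual positive and negative parts of [f]. *)
Lemma score_intensity_pair_score : score_intensity Q (pair_score H) =
  \int[Q]_psi (\esum_(b in atoms psi) (in_unit_cube b.1 * maxe (f psi b) 0)) -
  \int[Q]_psi (\esum_(b in atoms psi) (in_unit_cube b.1 * maxe (- f psi b) 0)).
Proof.
(* [PS] is the score of the point at the origin, [P2] its sum over the points
   of the cube, [P3] the same sum after the exchange of the points. *)
pose PS (G : borel V * borel M' * base -> \bar R) (psi : marked) : \bar R :=
  \esum_(b in atoms psi) G (b.1, b.2.2, shift b.1 (forget psi)).
pose P2 (G : borel V * borel M' * base -> \bar R) (psi : marked) : \bar R :=
  \esum_(x in locations psi `&` @unit_cube R d) PS G (shift x psi).
pose P3 (G : borel V * borel M' * base -> \bar R) (psi : marked) : \bar R :=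
  \esum_(b in atoms psi) (in_unit_cube b.1 *
    transported G (b.2.2, shift b.1 (forget psi))).
have mPS (G : borel V * borel M' * base -> \bar R) :
  (forall z, 0 <= G z) -> measurable_fun setT G -> measurable_fun setT (PS G).
  move=> G0 mG; apply: (@measurable_esum_atoms _ _ _ _ _ id _
    (fun z : marked * borel Y => G (z.2.1, z.2.2.2,
      shift z.2.1 (forget z.1)))) => //.
  have /measurable_fun_pairP[m1 m2] := @measurable_mark_shift R d M M'.
  exact: (measurableT_comp mG (measurable_fun_pair (measurable_fun_pair
    (measurableT_comp (@borel_fst R d _) measurable_snd) m1) m2)).
have PS0 (G : borel V * borel M' * base -> \bar R) psi :
  (forall z, 0 <= G z) -> 0 <= PS G psi by move=> G0; exact: esum_ge0.
have mP2 (G : borel V * borel M' * base -> \bar R) :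
  (forall z, 0 <= G z) -> measurable_fun setT G -> measurable_fun setT (P2 G).
  by move=> G0 mG; apply: measurable_cube_sum; [move=> psi; exact: PS0|exact: mPS].
have sPS psi : signed c (PS HP psi) (PS HN psi).
  by apply: signed_esum => b _; exact: sH.
have psE psi : pair_score H psi = PS HP psi - PS HN psi.
  exact: (esumNy_signed (fun b _ => HPN _ _ _) (fun b _ => sH _)).
have -> : score_intensity Q (pair_score H) =
  \int[Q]_psi P2 HP psi - \int[Q]_psi P2 HN psi.
  apply: (@expectNy_signed R _ _ Q c); [exact: mP2|exact: mP2| |].
    by move=> psi; exact: (esumNy_signed (fun x _ => psE _) (fun x _ => sPS _)).
  by move=> psi; apply: signed_esum => x _; exact: sPS.
have tP (G : borel V * borel M' * base -> \bar R) :
  (forall z, 0 <= G z) -> measurable_fun setT G ->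
    \int[Q]_psi P2 G psi = \int[Q]_psi P3 G psi.
  by move=> G0 mG; exact: (transport_pair_score statQ finQ G0 mG).
rewrite !tP//.
have mf : measurable_fun setT
    (fun z : borel M' * base => transported_score H z.1 z.2).
  exact: measurable_transported_score.
have ind_signed (i p n : \bar R) :
  i = 0 \/ i = 1 -> signed c p n -> signed c (i * p) (i * n).
  case=> -> [p0 n0 h]; rewrite ?mul0e ?mul1e; last by [].
  by split=> //; case: c h => // _; left.
have cube01 (x : V) : in_unit_cube x = 0 \/ in_unit_cube x = 1 :> \bar R.
  by rewrite /in_unit_cube indicE; case: (_ \in _); [right|left].
have cubeB (x : V) (p n : \bar R) :
  in_unit_cube x * (p - n) = in_unit_cube x * p - in_unit_cube x * n.
  by case: (cube01 x) => ->; rewrite ?mul0e ?mul1e ?sube0.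
pose E psi := esumNy (atoms psi) (fun b => in_unit_cube b.1 * f psi b).
transitivity (expectNy Q E).
  apply/esym; apply: (@expectNy_signed R _ _ Q c).
  - by apply: (measurable_mark_sum _ (measurable_transported HP0 mHP)) => z;
      exact: esum_ge0.
  - by apply: (measurable_mark_sum _ (measurable_transported HN0 mHN)) => z;
      exact: esum_ge0.
  - move=> psi; apply: (@esumNy_signed _ c) => b _; last exact: ind_signed.
    by rewrite /f transported_scoreE cubeB.
  - by move=> psi; apply: signed_esum => b _; exact: ind_signed.
have sf psi b : signed c (maxe (f psi b) 0) (maxe (- f psi b) 0).
  exact/signed_maxe/transported_score_sign.
apply: (@expectNy_signed R _ _ Q c).
- by apply: (measurable_mark_sum _ (measurable_maxe0 mf)) => z;
    rewrite le_max lexx orbT.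
- by apply: (measurable_mark_sum _ (measurable_maxeN0 mf)) => z;
    rewrite le_max lexx orbT.
- move=> psi; apply: (@esumNy_signed _ c) => b _; last exact: ind_signed.
  by rewrite -cubeB maxe_sub.
- by move=> psi; apply: signed_esum => b _; exact: ind_signed.
Qed.

End signed_score.

(** * Markings computed from the base process *)

Section marking.
Context (R : realType) (d : nat) (M M' : ptopologicalType).
Local Notation V := 'rV[R]_d.
Local Notation Y := (V * (M * M'))%type.
Local Notation base := (config R d M).
Local Notation marked := (config R d (M * M')%type).

Section mark.
Variable s : base -> M'.

(** A point receives the mark that [s] computes from the configuration as seen
   from this point, which makes marking commute with shifts. *)
Program Definition mark (phi : base) : marked :=
  @Config R d (M * M')%type ((fun a => (a.1, (a.2,
    s (shift a.1 phi)))) @` atoms phi) _ _.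
Next Obligation.
move=> phi B bB; apply: (@sub_finite_set _ _
  ((fun a : V * M => (a.1, (a.2,
    s (shift a.1 phi)))) @` (atoms phi `&` (B `*` setT)))).
  by move=> _ [[[x m] /= phia <-] [/= Bx _]]; exists (x, m).
by apply: finite_image; exact: config_locally_finite.
Qed.
Next Obligation.
move=> phi x m1 m2 [[x1 n1] /= a1 [<- <-]] [[x2 n2] /= a2 [e2 <-]].
by subst x2; rewrite (config_one_mark a1 a2).
Qed.

Lemma forget_mark phi : forget (mark phi) = phi.
Proof.
apply: config_ext; rewrite /= image_comp -[RHS]image_id.
by congr image; apply/funext => -[].
Qed.

Lemma mark_shift y phi : mark (shift y phi) = shift y (mark phi).
Proof.
apply: config_ext; rewrite /= !image_comp; congr image; apply/funext => a /=.
by rewrite shift_shift subrKC.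
Qed.

Lemma esum_atoms_mark phi (g : Y -> \bar R) :
  \esum_(b in atoms (mark phi)) g b =
  \esum_(a in atoms phi) g (a.1, (a.2, s (shift a.1 phi))).
Proof. by rewrite esum_image// => -[x m] [x' m'] _ _ /= [-> ->]. Qed.

End mark.

Variables (m : nat -> M') (k : base -> nat).
Hypothesis mk : forall j, measurable [set phi | k phi = j].

Lemma measurable_choice : measurable_fun setT ((m \o k) : base -> borel M').
Proof.
move=> _ B mB; rewrite setTI (_ :
  _ @^-1` _ = \bigcup_(j in [set j | B (m j)]) [set phi | k phi = j]).
  by apply: bigcup_measurable => j _; exact: mk.
apply/seteqP; split=> [phi Bk|phi [j Bj /= kj]]; first by exists (k phi).
by rewrite /= kj.
Qed.

(** The marks take countably many values, so that Borel sets of the product with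
   the space of marks are treated by sections: on the set where the mark is
   [m j], a condition on the new atom is a Borel condition on the old one. *)
Lemma measurable_mark : measurable_fun setT (mark (m \o k)).
Proof.
have mS : measurable_fun setT
    (fun z : base * borel (V * M)%type => shift z.2.1 z.1).
  apply: measurable_shift_comp => //.
  exact: (measurableT_comp (@borel_fst R d M) measurable_snd).
apply: measurable_config => B mB.
rewrite [X in measurable_fun _ X](_ : _ = fun phi : base =>
   \esum_(a in atoms phi) (\1_B (a.1, (a.2, m (k (shift a.1 phi)))))%:E);
     last first.
  by apply/funext => phi; rewrite evaluation_esum esum_atoms_mark.
apply: (@measurable_esum_atoms _ _ _ _ _ id _
  (fun z : base * borel (V * M)%type =>
    (\1_B (z.2.1, (z.2.2, m (k (shift z.2.1 z.1)))))%:E)) => //.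
pose D := \bigcup_j
  ((fun z : base * borel (V * M)%type => shift z.2.1 z.1) @^-1`
     [set phi | k phi = j] `&`
   (fun z : base * borel (V * M)%type => (z.2.1, (z.2.2, m j)) : borel Y) @^-1` B).
rewrite [X in measurable_fun _ X](_ : _ = fun z => (\1_D z)%:E).
  apply: measurable_indicE; apply: bigcupT_measurable => j; apply: measurableI.
    by rewrite -[X in measurable X]setTI; apply: mS.
  rewrite -[X in measurable X]setTI.
  apply: (@measurableT_comp _ _ _ _ _ _
    (fun a : borel (V * M)%type => (a.1, (a.2, m j)) : borel Y) _ snd) => //.
  apply: (@measurable_continuous (V * M)%type Y (fun a => (a.1, (a.2, m j)))).
  apply: continuous_pair; first exact: continuous_fst.
  apply: continuous_pair; first exact: continuous_snd.
  exact: cst_continuous.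
apply/funext => z; rewrite !indicE.
have [Bz|Bz] := pselect (B (z.2.1, (z.2.2, m (k (shift z.2.1 z.1))))).
  by rewrite !mem_set//; exists (k (shift z.2.1 z.1)).
by rewrite !memNset// => -[j _ [/= <-]].
Qed.

End marking.

Section markings.
Context (R : realType) (d : nat) (M M' : ptopologicalType).
Local Notation base := (config R d M).
Local Notation marked := (config R d (M * M')%type).
Variable mu : {measure set base -> \bar R}.

Section projection.
Variable Q : {measure set marked -> \bar R}.
Hypothesis forgetQ : forall A : set base, measurable A ->
  Q (@forget R d M M' @^-1` A) = mu A.

Lemma integral_forget (g : base -> \bar R) : (forall phi, 0 <= g phi) ->
  measurable_fun setT g -> \int[Q]_psi g (forget psi) = \int[mu]_phi g phi.
Proof.
move=> g0 mg; have mf := @measurable_forget R d M M'.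
rewrite -[LHS](@ge0_integral_pushforward _ _ _ _ _ _ mf Q setT g)//.
by apply: eq_measure_integral => A mA _; exact: forgetQ.
Qed.

Lemma intensity_forget : intensity Q = intensity mu.
Proof.
rewrite /intensity -integral_forget; last 2 first.
- exact: evaluation_ge0.
- exact: measurable_evaluation_cylinder (@measurable_unit_cube R d).
apply: eq_integral => psi _; rewrite !evaluation_esum esum_atoms_forget.
by apply: eq_esum => a _; rewrite !indicE; congr ((_ : bool)%:R%:E);
  apply/asboolP/asboolP.
Qed.

End projection.

End markings.

(** * Near-optimal measurable selection *)

Lemma second_countable_dense_sequence (T : ptopologicalType) :
  @second_countable T ->
  exists m : nat -> T, forall U : set T, open U -> U !=set0 -> exists k, U (m k).
Proof.
move=> [B /pfcard_geP[B0|[e]] [Bo Bb]].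
  by have [U []] := Bb point setT filterT; rewrite B0.
exists (fun k => xget point (e k)) => U oU [x Ux].
have [V [BV Vx] VU] := Bb x U (open_nbhs_nbhs (conj oU Ux)).
have [k _ ekV] : (e @` setT) V by rewrite (image_eq e).
exists k.
by apply: VU; rewrite -ekV; apply: xgetPex; exists x; rewrite ekV.
Qed.

Lemma ereal_sup_dense (R : realType) (T : ptopologicalType) (m : nat -> T)
    (g : T -> \bar R) :
  (forall U : set T, open U -> U !=set0 -> exists k, U (m k)) ->
  continuous g ->
  ereal_sup [set g t | t in [set: T]] = ereal_sup [set g (m k) | k in [set: nat]].
Proof.
move=> dm cg; apply/eqP; rewrite eq_le; apply/andP; split; last first.
  by apply: ereal_sup_le => _ [k _ <-]; exists (m k).
apply: ge_ereal_sup => _ [t _ <-]; rewrite leNgt; apply/negP => st.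
have og : open (g @^-1` [set y | ereal_sup [set g (m k) | k in [set: nat]] < y]).
  by move/continuousP: cg; apply; exact: open_ereal_gt_ereal.
have [k] := dm _ og (ex_intro _ t st).
by rewrite /= ltNge => /negP; apply; apply: ereal_sup_ubound; exists k.
Qed.

Lemma measurable_ereal_sup (R : realType) dX (X : measurableType dX)
    (g : nat -> X -> \bar R) : (forall k, measurable_fun setT (g k)) ->
  measurable_fun setT (fun x => ereal_sup [set g k x | k in [set: nat]]).
Proof.
move=> mg; rewrite [X in measurable_fun _ X](_ : _ = fun x => esups (g ^~ x) 0%N).
  exact: measurable_fun_esups.
by apply/funext => x; rewrite /esups /sdrop; congr ereal_sup; congr image;
  apply/seteqP; split.
Qed.

Lemma measurable_le_set (R : realType) dX (X : measurableType dX)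
    (u v : X -> \bar R) : measurable_fun setT u -> measurable_fun setT v ->
  (forall x, u x < +oo) -> measurable [set x | u x <= v x].
Proof.
move=> mu mv uoo.
(* [v x - u x] is -oo, not 0, where both functions are -oo. *)
rewrite (_ : [set x | _] =
    u @^-1` [set -oo] `|` (fun x => v x - u x) @^-1` `[0, +oo[%classic); last first.
  apply/seteqP; split=> x /=; rewrite in_itv/= andbT.
    have [->|uN] := eqVneq (u x) -oo; first by left.
    by move=> uv; right; rewrite sube_ge0// fin_numE uN lt_eqF.
  case=> [->|]; first exact: leNye.
  have [->|uN] := eqVneq (u x) -oo; first by rewrite leNye.
  by rewrite sube_ge0// fin_numE uN lt_eqF.
apply: measurableU; rewrite -[X in measurable X]setTI.
  by apply: mu => //; exact: emeasurable_set1.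
by apply: (emeasurable_funB mv mu) => //; exact: emeasurable_itv.
Qed.

Section selection.
Context (R : realType) dX (X : measurableType dX).
Variables (g : nat -> X -> \bar R) (n : nat).
Hypothesis mg : forall k, measurable_fun setT (g k).
Let s x := ereal_sup [set g k x | k in [set: nat]].

(** The truncation at [n] makes +oo approachable; the threshold of -oo is -oo
   and is reached by any value. *)
Definition threshold (y : \bar R) : \bar R := mine y n%:R%:E - n.+1%:R^-1%:E.

Let threshold_reached x : exists k, threshold (s x) <= g k x.
Proof.
have [sN|sN] := eqVneq (s x) -oo.
  by exists 0%N; rewrite /threshold sN minNye addNye leNye.
have ts : threshold (s x) < s x.
  rewrite /threshold; case: (s x) sN => [r| |//] _; last first.
    by rewrite minye -EFinB ltry.
  rewrite -EFin_min -EFinB lte_fin ltrBlDr; apply: le_lt_trans (_ : r < _)%R.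
    by rewrite ge_min lexx.
  by rewrite ltrDl invr_gt0.
have [_ [k _ <-] tk] := ereal_sup_gt ts; exists k; exact: ltW.
Qed.

(** Taking the first index makes the choice measurable. *)
Definition select x : nat := ex_minn (threshold_reached x).

Lemma select_ge x : threshold (s x) <= g (select x) x.
Proof. by rewrite /select; case: ex_minnP. Qed.

Lemma measurable_select j : measurable [set x | select x = j].
Proof.
have mt : measurable_fun setT (fun x => threshold (s x)).
  apply: emeasurable_funB => //; apply: measurable_mine => //.
  exact: measurable_ereal_sup.
pose A i := [set x | threshold (s x) <= g i x].
have mA i : measurable (A i).
  apply: measurable_le_set => // x; rewrite /threshold.
  apply: (@le_lt_trans _ _ (n%:R%:E - n.+1%:R^-1%:E)); last by rewrite -EFinB ltry.
  by rewrite leeB// ge_min lexx orbT.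
rewrite (_ : [set x | _] = A j `\` \bigcup_(i < j) A i).
  by apply: measurableD => //; apply: bigcup_measurable.
apply/seteqP; split=> x /=; rewrite /select; case: ex_minnP => k kx kmin.
  move=> <-; split=> // -[i /= ik Ai]; move: (kmin i Ai).
  by rewrite leqNgt ik.
move=> [Aj nA]; apply/eqP; rewrite eqn_leq kmin//= leqNgt; apply/negP => kj.
by apply: nA; exists k.
Qed.

End selection.

Lemma cvg_mine_nat (R : realType) (y : \bar R) : 0 <= y ->
  mine y n%:R%:E @[n --> \oo] --> y.
Proof.
case: y => [r r0| _|//]; last first.
  by under eq_fun do rewrite minye; apply/cvgenyP.
apply: cvg_near_cst; exists (Num.truncn r).+1 => // n /= rn.
apply/min_idPl; rewrite lee_fin ltW//; apply: lt_le_trans (truncnS_gt r) _.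
by rewrite ler_nat.
Qed.

Section near_optimal_selection.
Context (R : realType) dX (X : measurableType dX) (Q : {measure set X -> \bar R}).
Hypothesis Q1 : Q setT = 1.
Variables (s : X -> \bar R) (G : nat -> X -> \bar R).
Hypothesis ms : measurable_fun setT s.
Hypothesis mG : forall n, measurable_fun setT (G n).
Hypothesis sG : forall n x, threshold n (s x) <= G n x.

Let eps n : R := (n.+1%:R^-1)%R.
Let eps0 n : (0 <= eps n)%R. Proof. by rewrite invr_ge0. Qed.

Let sGe n x : mine (s x) n%:R%:E <= G n x + (eps n)%:E.
Proof. by rewrite -leeBlDr//; exact: sG. Qed.

Let neg_le n x : maxe (- G n x) 0 <= maxe (- s x) 0 + (eps n)%:E.
Proof.
rewrite ge_max; apply/andP; split; last first.
  by rewrite adde_ge0// ?lee_fin// le_max lexx orbT.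
have [h|h] := orP (le_total (s x) n%:R%:E).
  have := sGe n x; rewrite (min_idPl h) -leeBlDr// -leeN2 oppeB;
    last by rewrite fin_num_adde_defl.
  by move=> /le_trans; apply; rewrite leeD2r// le_max lexx.
have := sGe n x; rewrite (min_idPr h) -leeBlDr// => G1.
apply: (@le_trans _ _ (eps n)%:E); last by rewrite leeDr// le_max lexx orbT.
by rewrite leeNl (le_trans _ G1)// -EFinN -EFinB lee_fin lerBrDr addNr.
Qed.

Let pos_ge n x : mine (maxe (s x) 0) n%:R%:E <= maxe (G n x) 0 + (eps n)%:E.
Proof.
have [s0|s0] := orP (le_total 0 (s x)); last first.
  rewrite (max_idPr s0) (min_idPl _) ?lee_fin ?ler0n//.
  by rewrite adde_ge0// ?lee_fin// le_max lexx orbT.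
rewrite (max_idPl s0) (le_trans (sGe n x))// leeD2r// le_max lexx //.
Qed.

(** The negative part of [G n] exceeds that of [s] by at most 1/(n+1), and its
   positive part misses that of [s], truncated at [n], by at most 1/(n+1).  The
   integrals of the truncations increase to the integral of the positive part
   of [s]; if the negative part of [s] has integral +oo, the left-hand side is
   -oo. *)
Lemma expectation_near_optimal (L : \bar R) :
  (forall n, \int[Q]_x maxe (G n x) 0 - \int[Q]_x maxe (- G n x) 0 <= L) ->
  \int[Q]_x maxe (s x) 0 - \int[Q]_x maxe (- s x) 0 <= L.
Proof.
move=> GL; pose A n := \int[Q]_x mine (maxe (s x) 0) n%:R%:E.
set B := \int[Q]_x maxe (- s x) 0.
have B0 : 0 <= B by apply: integral_ge0 => x _; rewrite le_max lexx orbT.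
have [->|Boo] := eqVneq B +oo; first by rewrite addeNy leNye.
have Bfin : B \is a fin_num by rewrite ge0_fin_numE// ltey.
have msp : measurable_fun setT (fun x => maxe (s x) 0) by exact: measurable_maxe0.
have Ieps n (g : X -> \bar R) : (forall x, 0 <= g x) -> measurable_fun setT g ->
    \int[Q]_x (g x + (eps n)%:E) = \int[Q]_x g x + (eps n)%:E.
  move=> g0 mg; rewrite ge0_integralD//; last by move=> x _; rewrite lee_fin.
  by congr (_ + _); rewrite integral_cst// Q1 mule1.
have bn n : \int[Q]_x maxe (- G n x) 0 <= B + (eps n)%:E.
  rewrite -Ieps; [|by move=> x; rewrite le_max lexx orbT|exact: measurable_maxeN0].
  apply: ge0_le_integral => //.
  - by move=> x _; rewrite le_max lexx orbT.
  - exact: measurable_maxeN0.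
  - by apply: emeasurable_funD => //; exact: measurable_maxeN0.
have mAn n : measurable_fun setT (fun x => mine (maxe (s x) 0) n%:R%:E).
  by apply: measurable_mine.
have An0 n x : 0 <= mine (maxe (s x) 0) n%:R%:E.
  by rewrite le_min le_max lexx orbT lee_fin ler0n.
have an n : A n <= \int[Q]_x maxe (G n x) 0 + (eps n)%:E.
  rewrite -Ieps; [|by move=> x; rewrite le_max lexx orbT|exact: measurable_maxe0].
  apply: ge0_le_integral => //.
  by apply: emeasurable_funD => //; exact: measurable_maxe0.
have ALn n : A n <= L + B + (eps n + eps n)%:E.
  apply: (le_trans (an n)); rewrite EFinD addeA leeD2r//.
  have bfin : \int[Q]_x maxe (- G n x) 0 \is a fin_num.
    rewrite ge0_fin_numE; last by apply: integral_ge0 => x _;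
      rewrite le_max lexx orbT.
    by apply: le_lt_trans (bn n) _; rewrite -(fineK Bfin) -EFinD ltry.
  have := GL n; rewrite leeBlDr// => /le_trans; apply.
  by rewrite -addeA leeD2l.
have A_nd : {homo A : i j / (i <= j)%N >-> i <= j}.
  move=> i j ij; apply: ge0_le_integral => // x _.
  by rewrite le_min ge_min lexx /= ge_min lee_fin ler_nat ij orbT.
have AL n : A n <= L + B.
  apply/lee_addgt0Pr => e e0.
  have e20 : (0 < e / 2)%R by rewrite divr_gt0.
  have [k _ /(_ k (leqnn k)) ke] := near_infty_natSinv_lt (PosNum e20).
  apply: (le_trans (A_nd _ _ (leq_maxl n k))); apply: (le_trans (ALn _)).
  rewrite leeD2l// lee_fin [leRHS]splitr.
  have : (eps (maxn n k) <= e / 2)%R.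
    apply: ltW; apply: le_lt_trans ke; rewrite lef_pV2 ?posrE// ler_nat ltnS.
    exact: leq_maxr.
  by move=> h; exact: lerD.
have -> : \int[Q]_x maxe (s x) 0 = limn A.
  rewrite -monotone_convergence//.
    apply: eq_integral => x _; apply/esym/cvg_lim => //.
    by apply: cvg_mine_nat; rewrite le_max lexx orbT.
  move=> x _ i j ij.
  by rewrite le_min ge_min lexx /= ge_min lee_fin ler_nat ij orbT.
rewrite leeBlDr//; apply: lime_le; first exact: ereal_nondecreasing_is_cvgn.
by near=> n; exact: AL.
Unshelve. all: by end_near. Qed.

End near_optimal_selection.

(** * The optimal score intensity for a score defined everywhere *)

Lemma muleB_EFin (R : realType) (r : R) (a b : \bar R) : (0 < r)%R ->
  0 <= a -> 0 <= b -> r%:E * (a - b) = r%:E * a - r%:E * b.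
Proof.
move=> r0 a0 b0; have [->|boo] := eqVneq b +oo.
  by rewrite gt0_muley ?lte_fin// !addeNy gt0_muleNy ?lte_fin.
have bfin : b \is a fin_num by rewrite ge0_fin_numE// ltey.
by rewrite muleBr// fin_num_adde_defl// fin_numN.
Qed.

Section optimal_score.
Context (R : realType) (d : nat) (M M' : ptopologicalType).
Local Notation V := 'rV[R]_d.
Local Notation Y := (V * (M * M'))%type.
Local Notation base := (config R d M).
Local Notation marked := (config R d (M * M')%type).
Hypothesis scM' : @second_countable M'.
Context dO (Omega : measurableType dO) (P : probability Omega R).
Variable Phi : {RV P >-> base}.
Let mu : probability base R := distribution P Phi.
Hypothesis statmu : stationary mu.
Hypothesis intmu : 0 < intensity mu < +oo.

Lemma marking_exists (m : nat -> M') (k : base -> nat) :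
  (forall j, measurable [set phi | k phi = j]) ->
  exists2 Q : probability marked R,
    @stationary_markings R d M M' mu Q &
    forall A, measurable A -> Q A = mu (mark (m \o k) @^-1` A).
Proof.
move=> mk; have mm := measurable_mark m mk.
pose X : {mfun Omega >-> marked} := HB.pack (mark (m \o k) \o Phi)
  (isMeasurableFun.Build _ _ _ _ _ (measurableT_comp mm (measurable_funPT Phi))).
exists (distribution P X) => //; split=> [y A mA|A mA].
  rewrite -[RHS]/(mu (mark (m \o k) @^-1` A)) -(statmu y); last first.
    by rewrite -[X in measurable X]setTI;
      exact: (measurable_mark m mk measurableT mA).
  rewrite -[LHS]/(mu (mark (m \o k) @^-1` (shift y @^-1` A))); congr (mu _).
  by apply/seteqP; split=> phi; rewrite /= mark_shift.
rewrite -[LHS]/(mu (mark (m \o k) @^-1` (@forget R d M M' @^-1` A))); congr (mu _).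
by apply/seteqP; split=> phi; rewrite /= forget_mark.
Qed.

Lemma cube_sum_forget (g : base -> \bar R) (psi : marked) :
  cube_sum g (forget psi) =
  \esum_(b in atoms psi) (in_unit_cube b.1 * g (shift b.1 (forget psi))).
Proof. by rewrite /cube_sum esum_locations esum_atoms_forget. Qed.

Let pm := palm_measure intmu.

Lemma integral_cube_sum_forget (Q : {measure set marked -> \bar R})
    (g : base -> \bar R) :
  (forall A : set base, measurable A -> Q (@forget R d M M' @^-1` A) = mu A) ->
  (forall phi, 0 <= g phi) -> measurable_fun setT g ->
  \int[Q]_psi cube_sum g (forget psi) = intensity mu * \int[pm]_phi g phi.
Proof.
move=> fQ g0 mg; rewrite (integral_forget fQ).
- by rewrite intensity_mul_palm.
- by move=> phi; exact: cube_sum_ge0.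
- exact: measurable_cube_sum.
Qed.

Variables (c : bool) (H : V -> M' -> base -> \bar R).
Hypothesis mH : measurable_fun setT
  (fun p : borel V * borel M' * base => H p.1.1 p.1.2 p.2).
Hypothesis cH : forall x m' phi,
  if c then 0 <= H x m' phi \/ H x m' phi = -oo else H x m' phi <= 0.

Let f := transported_score H.
Let mf : measurable_fun setT (fun z : borel M' * base => f z.1 z.2).
Proof. exact: (measurable_transported_score mH cH). Qed.

Let measurable_score_at (sel : base -> M') :
  measurable_fun setT (sel : base -> borel M') ->
  measurable_fun setT (fun phi => f (sel phi) phi).
Proof.
move=> msel; by have := measurableT_comp mf
  (measurable_fun_pair msel (@measurable_id _ base setT)).
Qed.

(** The upper bound: once [f] is replaced by [s], which does not see the new
   marks, the sum over the cube is a Palm integral for the base process. *)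
Lemma score_intensity_le (s : base -> \bar R)
    (Q : {measure set marked -> \bar R}) :
  stationary Q ->
  (forall A : set base, measurable A -> Q (@forget R d M M' @^-1` A) = mu A) ->
  measurable_fun setT s -> (forall m' phi, f m' phi <= s phi) ->
  score_intensity Q (pair_score H) <=
  intensity mu * \int[pm]_phi maxe (s phi) 0 - intensity mu * \int[pm]_phi maxe
    (- s phi) 0.
Proof.
move=> statQ fQ ms fs.
have finQ : intensity Q < +oo by rewrite (intensity_forget fQ); case/andP: intmu.
have ge0 (x : \bar R) : 0 <= maxe x 0 by rewrite le_max lexx orbT.
rewrite (score_intensity_pair_score mH cH statQ finQ).
rewrite -(integral_cube_sum_forget fQ) //; last exact: measurable_maxe0.
rewrite -(integral_cube_sum_forget fQ) //; last exact: measurable_maxeN0.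
have mcs (g : base -> \bar R) : (forall phi, 0 <= g phi) -> measurable_fun setT g ->
    measurable_fun setT (fun psi : marked => cube_sum g (forget psi)).
  move=> g0 mg; exact: (measurableT_comp (measurable_cube_sum g0 mg)
    (@measurable_forget R d M M')).
have cube0 (x : V) : 0 <= in_unit_cube x :> \bar R by rewrite lee_fin.
apply: leeB; apply: ge0_le_integral => //.
- by move=> psi _; apply: esum_ge0 => b _; exact: mule_ge0.
- exact: (measurable_mark_sum (fun z => ge0 _) (measurable_maxe0 mf)).
- by apply: mcs => //; exact: measurable_maxe0.
- move=> psi _; rewrite cube_sum_forget; apply: le_esum => b _;
    apply: lee_pmul => //.
  by rewrite ge_max ge0 andbT le_max fs.
- by move=> psi _; rewrite cube_sum_forget; apply: esum_ge0 => b _; exact: mule_ge0.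
- by apply: mcs => //; exact: measurable_maxeN0.
- exact: (measurable_mark_sum (fun z => ge0 _) (measurable_maxeN0 mf)).
- move=> psi _; rewrite cube_sum_forget; apply: le_esum => b _;
    apply: lee_pmul => //.
  by rewrite ge_max ge0 andbT le_max leeN2 fs.
Qed.

(** A mark computed from the configuration seen from the point turns the score
   intensity into the Palm integral of [f] at this mark. *)
Lemma score_intensity_mark (m : nat -> M') (k : base -> nat)
    (Q : {measure set marked -> \bar R}) :
  (forall j, measurable [set phi | k phi = j]) ->
  stationary Q ->
  (forall A : set base, measurable A -> Q (@forget R d M M' @^-1` A) = mu A) ->
  (forall A, measurable A -> Q A = mu (mark (m \o k) @^-1` A)) ->
  score_intensity Q (pair_score H) =
  intensity mu * \int[pm]_phi maxe (f (m (k phi)) phi) 0 -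
  intensity mu * \int[pm]_phi maxe (- f (m (k phi)) phi) 0.
Proof.
move=> mk statQ fQ QE; have mm := measurable_mark m mk.
have finQ : intensity Q < +oo by rewrite (intensity_forget fQ); case/andP: intmu.
have ge0 (x : \bar R) : 0 <= maxe x 0 by rewrite le_max lexx orbT.
have mfk : measurable_fun setT (fun phi => f (m (k phi)) phi).
  exact: measurable_score_at (measurable_choice m mk).
rewrite (score_intensity_pair_score mH cH statQ finQ) !intensity_mul_palm//;
  last 2 first.
- exact: measurable_maxeN0.
- exact: measurable_maxe0.
have E (g : borel M' * base -> \bar R) :
  (forall z, 0 <= g z) -> measurable_fun setT g ->
    \int[Q]_psi (\esum_(b in atoms psi) (in_unit_cube b.1 * g (b.2.2,
      shift b.1 (forget psi)))) =
    \int[mu]_phi cube_sum (fun phi => g (m (k phi), phi)) phi.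
  move=> g0 mg; transitivity (\int[pushforward mu (mark (m \o k))]_psi
      (\esum_(b in atoms psi) (in_unit_cube b.1 * g (b.2.2,
        shift b.1 (forget psi))))).
    by apply: eq_measure_integral => A mA _; exact: QE.
  rewrite ge0_integral_pushforward//.
  - apply: eq_integral => phi _; apply: etrans (esum_atoms_mark _ _ _) _.
    by rewrite forget_mark /cube_sum esum_locations.
  - exact: measurable_mark_sum.
  - move=> psi _; apply: esum_ge0 => b _; apply: mule_ge0 => //.
    by rewrite lee_fin.
congr (_ - _).
  exact: (E (fun z => maxe (f z.1 z.2) 0) (fun z => ge0 _) (measurable_maxe0 mf)).
exact: (E (fun z => maxe (- f z.1 z.2) 0) (fun z => ge0 _) (measurable_maxeN0 mf)).
Qed.

Hypothesis cf : {ae palm mu, forall phi, continuous (fun m' => f m' phi)}.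

Lemma opt_score_intensity_total :
  opt_score_intensity mu (pair_score H) =
  intensity mu * expectNy (palm mu) (fun phi =>
    ereal_sup [set f m' phi | m' in [set: M']]).
Proof.
have [m dm] := second_countable_dense_sequence scM'.
pose g k phi := f (m k) phi.
have mg k : measurable_fun setT (g k).
  by apply: (@measurable_score_at (fun=> m k)); exact: measurable_cst.
pose s phi := ereal_sup [set g k phi | k in [set: nat]].
have ms : measurable_fun setT s by exact: measurable_ereal_sup.
move: cf; rewrite palmE => -[N [mN N0 cN]].
have sE phi : ~ N phi -> ereal_sup [set f m' phi | m' in [set: M']] = s phi.
  move=> nN; apply: ereal_sup_dense => //.
  by apply: contrapT => nc; apply: nN; exact: cN.
(* With the value +oo on the null set where continuity may fail, [s'] bounds
   [f] on all configurations. *)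
pose s' phi := if phi \in N then +oo else s phi.
have ms' : measurable_fun setT s'.
  apply: measurable_fun_ifT => //; apply: (measurable_fun_bool true).
  rewrite setTI (_ : _ @^-1` _ = N)//.
  by apply/seteqP; split=> phi /=; [exact: set_mem|exact: mem_set].
have fs' m' phi : f m' phi <= s' phi.
  rewrite /s'; case: ifPn => [_|/negP nN]; first exact: leey.
  rewrite -sE; first by apply: ereal_sup_ubound; exists m'.
  by move=> Nphi; apply: nN; exact: mem_set.
rewrite -/pm.
have E1 : expectNy pm (fun phi => ereal_sup [set f m' phi | m' in [set: M']]) =
    expectNy pm s.
  exact: (expectNy_off_null mN N0 sE).
have E2 : expectNy pm s = expectNy pm s'.
  by apply: (expectNy_off_null mN N0) => phi nN; rewrite /s' memNset.
have [l0 lE] := (fine_intensity_gt0 intmu, intensity_fin intmu).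
have I0 (u : base -> \bar R) : 0 <= \int[pm]_phi maxe (u phi) 0.
  by apply: integral_ge0 => phi _; rewrite le_max lexx orbT.
rewrite E1; apply/eqP; rewrite eq_le; apply/andP; split.
  apply: ge_ereal_sup => _ [Q [statQ fQ] <-].
  rewrite E2 expectNyE// -lE muleB_EFin// lE.
  exact: score_intensity_le.
rewrite expectNyE// -lE -lee_pdivlMl//.
apply: (expectation_near_optimal (palm_measureT intmu) ms
  (G := fun n phi => g (select g n phi) phi)) => [n|n phi|n].
- exact: measurable_score_at (measurable_choice m (measurable_select n mg)).
- exact: select_ge.
rewrite lee_pdivlMl// muleB_EFin// lE.
have [Q [statQ fQ] QE] := marking_exists m (measurable_select n mg).
apply: ereal_sup_ubound; exists Q => //.
exact: (score_intensity_mark (measurable_select n mg) statQ fQ QE).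
Qed.

End optimal_score.

(** * Configurations with a point at the origin *)

Section at_origin.
Context (R : realType) (d : nat) (M M' : ptopologicalType).
Local Notation V := 'rV[R]_d.

Lemma measurable_at_origin : measurable (@at_origin R d M).
Proof.
have m0 : measurable ([set 0%R] : set (borel V)).
  apply: (@measurable_closed V); apply: accessible_closed_set1.
  exact: hausdorff_accessible (@norm_hausdorff R V).
have -> : @at_origin R d M = ~` (evaluation ([set 0%R] `*` setT) @^-1` [set 0]).
  apply/seteqP; split=> phi.
    move=> [a phia a0] /evaluation_eq0 E.
    have : (atoms phi `&` ([set 0%R] `*` setT)) a by split.
    by rewrite E.
  move=> /= phi0; apply: contrapT => nphi; apply: phi0.
  rewrite /evaluation counting_esum (_ : _ `&` _ = set0) ?esum_set0//.
  by apply/seteqP; split=> // a [phia [a0 _]]; apply: nphi; exists a.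
apply: measurableC; rewrite -[X in measurable X]setTI.
by apply: (measurable_evaluation_cylinder m0) => //; exact: emeasurable_set1.
Qed.

Lemma palm_off_origin (Q : {measure set (config R d M) -> \bar R})
    (lQ : 0 < intensity Q < +oo) : palm_measure lQ (~` @at_origin R d M) = 0.
Proof.
rewrite /palm_measure /= /mscale /= /campbell_measure integral0_eq ?mule0// =>
  phi _.
rewrite cube_sum_atoms// esum1// => a [phia _].
by rewrite indicE memNset// => /(_ (at_origin_shift phia)).
Qed.

Variable H : V -> M' -> config R d M -> \bar R.

(** [H] is only measurable on the configurations with a point at the origin;
   the value 0 elsewhere belongs to both classes of admissible values. *)
Definition score_at_origin (x : V) (m' : M') (phi : config R d M) : \bar R :=
  if phi \in @at_origin R d M then H x m' phi else 0.

Lemma measurable_score_at_origin :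
  measurable_fun
    [set p : borel V * borel M' * config R d M | at_origin p.2]
    (fun p => H p.1.1 p.1.2 p.2) ->
  measurable_fun setT (fun p : borel V * borel M' * config R d M =>
    score_at_origin p.1.1 p.1.2 p.2).
Proof.
move=> mH.
have mo : measurable [set p : borel V * borel M' * config R d M | at_origin p.2].
  rewrite -[X in measurable X]setTI.
  exact: (@measurable_snd _ _ (borel V * borel M')%type (config R d M)
    measurableT _ measurable_at_origin).
exact: (proj1 (measurable_restrictT _ mo) mH).
Qed.

Lemma pair_score_at_origin : pair_score H = pair_score score_at_origin.
Proof.
apply/funext => psi; rewrite /pair_score !esumNyE.
by congr (_ - _); apply: eq_esum => a psia; rewrite /score_at_origin mem_set//;
  apply: (@at_origin_shift _ _ _ (forget psi) (a.1, a.2.1)); exists a.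
Qed.

Lemma transported_score_at_origin m' phi : at_origin phi ->
  transported_score H m' phi = transported_score score_at_origin m' phi.
Proof. by move=> or0; rewrite /transported_score /score_at_origin mem_set. Qed.

End at_origin.

Theorem proposition2p4 (R : realType) (d : nat) (d_gt0 : (0 < d)%N)
  (M M' : ptopologicalType)
  (lcM : locally_compact [set: M]) (scM : @second_countable M)
  (hausM : hausdorff_space M)
  (lcM' : locally_compact [set: M']) (scM' : @second_countable M')
  (hausM' : hausdorff_space M')
  (dO : measure_display) (Omega : measurableType dO) (P : probability Omega R)
  (Phi : {RV P >-> config R d M})
  (Phi_stationary : stationary (distribution P Phi))
  (Phi_intensity : 0 < intensity (distribution P Phi) < +oo)
  (H : 'rV[R]_d -> M' -> config R d M -> \bar R)
  (H_measurable : measurable_fun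
    [set p : borel 'rV[R]_d * borel M' * config R d M | at_origin p.2]
    (fun p => H p.1.1 p.1.2 p.2))
  (H_values :
    (forall x m' phi, at_origin phi ->
       0 <= H x m' phi < +oo \/ H x m' phi = -oo) \/
    (forall x m' phi, at_origin phi -> H x m' phi <= 0))
  (f_continuous : {ae palm (distribution P Phi), forall phi,
    continuous (fun m' => transported_score H m' phi)}) :
  opt_score_intensity (distribution P Phi) (pair_score H) =
  intensity (distribution P Phi) *
    expectNy (palm (distribution P Phi))
      (fun phi => ereal_sup [set transported_score H m' phi | m' in [set: M']]).
Proof.
have [c cH] : exists c, forall x m' phi,
    if c then 0 <= score_at_origin H x m' phi \/ score_at_origin H x m' phi = -oo
    else score_at_origin H x m' phi <= 0.
  case: H_values => h; [exists true|exists false] => x m' phi;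
    rewrite /score_at_origin; case: ifPn => [/set_mem or0|_] //.
  - by case: (h x m' phi or0) => [/andP[]|]; [left|right].
  - by left.
  - exact: h.
rewrite pair_score_at_origin.
have off0 := palm_off_origin Phi_intensity.
have moff := measurableC (@measurable_at_origin R d M).
have scoreE phi : at_origin phi ->
    (fun m' => transported_score (score_at_origin H) m' phi) =
    (fun m' => transported_score H m' phi).
  by move=> phi0; apply/funext => m'; exact/esym/transported_score_at_origin.
rewrite (opt_score_intensity_total scM' Phi_stationary Phi_intensity
  (measurable_score_at_origin H_measurable) cH).
  rewrite !palmE (expectNy_off_null moff off0 (g := fun phi =>
    ereal_sup [set transported_score H m' phi | m' in [set: M']]))//.
  by move=> phi /contrapT phi0; rewrite scoreE.
have aeo : {ae palm_measure Phi_intensity, forall phi, at_origin phi}.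
  by exists (~` @at_origin R d M); split.
move: f_continuous; rewrite palmE => aec.
by apply: filterS2 aeo aec => phi phi0; rewrite scoreE.
Qed.
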